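(* For any $n>0$, $$\Omega_n\cdot\mathbf{M}_n=\mathrm{span}\{\mathbf{w}(\chi)\mid\chi\in\mathbb{Z}^n\},$$ and hence all elements of the non-zero $\mathcal{H}$-submodule $\Omega_n\cdot\mathbf{M}_n$ of $\mathbf{M}_n$ are singular.
   Context: Let $\mathbb{k}$ be a field of characteristic zero. Let $\mathrm{sl}(2)$ be the Lie algebra over $\mathbb{k}$ with basis $e,f,h$ and $[e,f]=h$, $[h,e]=2e$, $[h,f]=-2f$. Let $\mathfrak{g}=\mathrm{sl}(2)\otimes\mathbb{k}[t^{\pm1}]$ be the loop algebra, with $x(k)=x\otimes t^k$ and $[x(k),y(l)]=[x,y](k+l)$. Put $\mathcal{E}=\bigoplus_{j\in\mathbb{Z}}\mathbb{k}e(j)$, $\mathcal{H}=\bigoplus_{j\in\mathbb{Z}}\mathbb{k}h(j)$, $\mathcal{F}=\bigoplus_{j\in\mathbb{Z}}\mathbb{k}f(j)$. Let $\mathbf{M}(0)=\mathrm{Ind}_{\mathcal{H}\oplus\mathcal{E}}^{\mathfrak{g}}\,\mathbb{k}u_0$ be the $\mathfrak{g}$-module induced from the one-dimensional module $\mathbb{k}u_0$ with $(\mathcal{H}\oplus\mathcal{E})\cdot u_0=0$. For $n\geq 0$, $\mathbf{M}_n=\{v\in\mathbf{M}(0): h(0)v=-2nv\}$ is the $n$-th layer, an $\mathcal{H}$-module; it is spanned by the elements $f(\chi_1)\cdots f(\chi_n)u_0$, $\chi\in\mathbb{Z}^n$. An element $v\in\mathbf{M}(0)$ is called singular if $\mathcal{E}\cdot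 v=0$. For $n>0$ and $\chi\in\mathbb{Z}^n$ put $\mathbf{w}(\chi)=\sum_{\sigma\in\mathrm{Sym}(n)}\mathrm{sgn}(\sigma)\prod_{1\leq i\leq n}f(\chi_i+\sigma(i))\,u_0\in\mathbf{M}_n$. For $n>0$, $\mathbf{A}_n=\mathbb{k}[z_1^{\pm1},\dots,z_n^{\pm1}]^{\mathrm{Sym}(n)}$ is the algebra of symmetric Laurent polynomials, and $\mathbf{m}(\gamma)=\frac1{n!}\sum_{\sigma\in\mathrm{Sym}(n)}\prod_{i=1}^n z_{\sigma(i)}^{\gamma_i}$ for $\gamma\in\mathbb{Z}^n$ (these span $\mathbf{A}_n$). The layer $\mathbf{M}_n$ is regarded as an $\mathbf{A}_n$-module via linear extension of $\mathbf{m}(\gamma)\cdot f(\chi_1)\cdots f(\chi_n)u_0=\frac1{n!}\sum_{\sigma\in\mathrm{Sym}(n)}\prod_{i=1}^n f(\chi_i+\gamma_{\sigma(i)})\,u_0$, $\gamma,\chi\in\mathbb{Z}^n$. Finally $\Omega_n=\prod_{1\leq i<j\leq n}(z_i-z_j)^2\in\mathbf{A}_n$ and $\Omega_n\cdot\mathbf{M}_n=\{\Omega_n\cdot v: v\in\mathbf{M}_n\}$. *)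

(* Defs.v *)
From HB Require Import structures.
From mathcomp Require Import all_boot all_order all_fingroup all_algebra.
From mathcomp Require Import finmap ring.
From mathcomp Require Export monalg.

Set Implicit Arguments.
Unset Strict Implicit.
Unset Printing Implicit Defensive.

Import GRing.Theory.

Local Open Scope ring_scope.

(* The group algebra R[G] of an additively written abelian group G. The ring  *)
(* structure provided with {malg R[K]} requires the monoid K to have no unit  *)
(* other than 1, so only its module structure is reused here. The basis       *)
(* element of R[G] attached to x : G is << x >>, and << x >> * << y >> is     *)
(* << x + y >>.                                                               *)
Section GroupAlgebra.
Context (R : comNzRingType) (G : zmodType).

Definition grpalg : Type := {malg R[G]}.

HB.instance Definition _ := GRing.Lmodule.copy grpalg {malg R[G]}.

Implicit Types (p q : {malg R[G]}).

Definition ga_one : {malg R[G]} := << 0 >>.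

Definition ga_mul p q : {malg R[G]} :=
  \sum_(x <- msupp p) \sum_(y <- msupp q) << p@_x * q@_y *g x + y >>.

Lemma ga_mulw (d1 d2 : {fset G}) p q :
  (msupp p `<=` d1)%fset -> (msupp q `<=` d2)%fset ->
  ga_mul p q = \sum_(x <- d1) \sum_(y <- d2) << p@_x * q@_y *g x + y >>.
Proof.
move=> le_d1 le_d2; rewrite /ga_mul (big_fset_incl _ le_d1) /=.
  apply/eq_bigr=> x _; apply/big_fset_incl => // y _ /mcoeff_outdom ->.
  by rewrite mulr0 monalgU0.
move=> x _ /mcoeff_outdom px.
by rewrite big1 => // y _; rewrite px mul0r monalgU0.
Qed.

Lemma ga_mulC : commutative ga_mul.
Proof.
move=> p q; rewrite /ga_mul exchange_big /=.
by apply/eq_bigr=> y _; apply/eq_bigr=> x _; rewrite mulrC addrC.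
Qed.

Lemma ga_mulDl : left_distributive ga_mul +%R.
Proof.
move=> p1 p2 q.
rewrite [ga_mul p1 _](ga_mulw (fsubsetUl _ (msupp p2)) (fsubset_refl _)).
rewrite [ga_mul p2 _](ga_mulw (fsubsetUr (msupp p1) _) (fsubset_refl _)).
rewrite (ga_mulw (msuppD_le _ _) (fsubset_refl _)) -big_split /=.
apply/eq_bigr=> x _; rewrite -big_split /=; apply/eq_bigr=> y _.
by rewrite mcoeffD mulrDl monalgUD.
Qed.

Lemma ga_mulDr : right_distributive ga_mul +%R.
Proof. by move=> p q1 q2; rewrite !(ga_mulC p) ga_mulDl. Qed.

Lemma ga_mul0l : left_zero 0 ga_mul.
Proof. by move=> q; rewrite /ga_mul msupp0 big_seq_fset0. Qed.

Lemma ga_mul0r : right_zero 0 ga_mul.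
Proof. by move=> p; rewrite ga_mulC ga_mul0l. Qed.

Lemma ga_mulUU a b x y :
  ga_mul << a *g x >> << b *g y >> = << a * b *g x + y >>.
Proof. by rewrite (ga_mulw msuppU_le msuppU_le) !big_seq_fset1 !mcoeffUU. Qed.

Lemma ga_mul_sumr I (r : seq I) p (F : I -> {malg R[G]}) :
  ga_mul p (\sum_(i <- r) F i) = \sum_(i <- r) ga_mul p (F i).
Proof. exact: (big_morph _ (ga_mulDr p) (ga_mul0r p)). Qed.

Lemma ga_mul_suml I (r : seq I) q (F : I -> {malg R[G]}) :
  ga_mul (\sum_(i <- r) F i) q = \sum_(i <- r) ga_mul (F i) q.
Proof.
by rewrite ga_mulC ga_mul_sumr; apply: eq_bigr=> i _; apply: ga_mulC.
Qed.

Lemma ga_mul1 : left_id ga_one ga_mul.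
Proof.
move=> p; rewrite [in LHS](monalgE p) ga_mul_sumr [RHS]monalgE.
by apply: eq_bigr=> x _; rewrite ga_mulUU mul1r add0r.
Qed.

Lemma ga_mulA : associative ga_mul.
Proof.
move=> p q r; rewrite (monalgE p) !ga_mul_suml; apply: eq_bigr=> x _.
rewrite (monalgE q) ga_mul_sumr !ga_mul_suml ga_mul_sumr.
apply: eq_bigr=> y _; rewrite (monalgE r) !ga_mul_sumr.
by apply: eq_bigr=> z _; rewrite !ga_mulUU mulrA addrA.
Qed.

Lemma ga_one_neq0 : ga_one != 0.
Proof. by rewrite monalgU_eq0 oner_eq0. Qed.

HB.instance Definition _ := GRing.Zmodule_isComNzRing.Build grpalg
  ga_mulA ga_mulC ga_mul1 ga_mulDl ga_one_neq0.

Lemma ga_scaleAl (c : R) (p q : grpalg) : c *: (p * q) = c *: p * q.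
Proof.
have scU a x : c *: << a *g x >> = << c * a *g x >> :> {malg R[G]}.
  by apply/malgP=> y; rewrite mcoeffZ !mcoeffU mulrnAr.
rewrite -[p * q]/(ga_mul p q) -[c *: p * q]/(ga_mul (c *: p) q).
rewrite (monalgE p) ga_mul_suml !scaler_sumr ga_mul_suml.
apply: eq_bigr=> x _; rewrite scU (monalgE q) !ga_mul_sumr scaler_sumr.
by apply: eq_bigr=> y _; rewrite !ga_mulUU scU mulrA.
Qed.

HB.instance Definition _ := GRing.Lmodule_isLalgebra.Build R grpalg ga_scaleAl.
HB.instance Definition _ := GRing.Lalgebra_isComAlgebra.Build R grpalg.

End GroupAlgebra.

HB.mixin Record Lmodule_isLieAlgebra (k : comNzRingType) L
    of GRing.Lmodule k L := {
  lie : L -> L -> L;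
  lie_linearl : forall z a x y, lie (a *: x + y) z = a *: lie x z + lie y z;
  lie_linearr : forall z a x y, lie z (a *: x + y) = a *: lie z x + lie z y;
  lie_alt : forall x, lie x x = 0;
  lie_jacobi : forall x y z,
    lie x (lie y z) + lie y (lie z x) + lie z (lie x y) = 0
}.

#[short(type="lieAlgType")]
HB.structure Definition LieAlgebra (k : comNzRingType) :=
  { L of GRing.Lmodule k L & Lmodule_isLieAlgebra k L }.

HB.mixin Record Lmodule_isLieModule (k : comNzRingType) (g : lieAlgType k) M
    of GRing.Lmodule k M := {
  lact : g -> M -> M;
  lact_linearl : forall v a x y,
    lact (a *: x + y) v = a *: lact x v + lact y v;
  lact_linearr : forall x a v w,
    lact x (a *: v + w) = a *: lact x v + lact x w;
  lact_lie : forall x y v,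
    lact (lie x y) v = lact x (lact y v) - lact y (lact x v)
}.

#[short(type="lieModType")]
HB.structure Definition LieModule (k : comNzRingType) (g : lieAlgType k) :=
  { M of GRing.Lmodule k M & Lmodule_isLieModule k g M }.

Definition lie_hom (k : comNzRingType) (g : lieAlgType k)
    (M N : lieModType g) (phi : M -> N) : Prop :=
  linear phi /\ forall x v, phi (lact x v) = lact x (phi v).

(* (M, iota) is Ind_b^g W = U(g) (x)_U(b) W, where b is a subalgebra of g and *)
(* W is a b-module with action tau: iota is b-linear, and every b-linear map  *)
(* from W to a g-module extends uniquely along iota to a g-linear map on M.   *)
Definition is_induced (k : comNzRingType) (g : lieAlgType k) (b : g -> Prop)
    (W : lmodType k) (tau : g -> W -> W) (M : lieModType g) (iota : W -> M) :
    Prop :=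
  let b_hom (N : lieModType g) (phi : W -> N) :=
    linear phi /\ forall x w, b x -> phi (tau x w) = lact x (phi w) in
  b_hom M iota /\
  forall (N : lieModType g) (phi : W -> N), b_hom N phi ->
    exists psi : M -> N,
      [/\ lie_hom psi, forall w, psi (iota w) = phi w
        & forall psi' : M -> N, lie_hom psi' ->
            (forall w, psi' (iota w) = phi w) -> psi' =1 psi].

(* sl(2) (x) A for a commutative k-algebra A: the triple (a, b, c) stands for *)
(* e (x) a + f (x) b + h (x) c.                                               *)
Section Sl2.
Context (k : comNzRingType) (A : comAlgType k).

Definition sl2 : Type := (A * A * A)%type.

HB.instance Definition _ := GRing.Lmodule.copy sl2 (A * A * A)%type.

Lemma sl2P (x y : sl2) :
  x.1.1 = y.1.1 -> x.1.2 = y.1.2 -> x.2 = y.2 -> x = y.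
Proof. by case: x y => [[a b] c] [[a' b'] c'] /= -> -> ->. Qed.

Definition sl2_lie (x y : sl2) : sl2 :=
  let: (a, b, c) := x in let: (a', b', c') := y in
  (2 * (c * a' - a * c'), - (2 * (c * b' - b * c')), a * b' - b * a').

Lemma sl2_lie_linearl (z : sl2) (r : k) (x y : sl2) :
  sl2_lie (r *: x + y) z = r *: sl2_lie x z + sl2_lie y z.
Proof.
case: x y z => [[a b] c] [[a' b'] c'] [[a'' b''] c''].
have [s scE] : exists s : A, forall u : A, r *: u = s * u.
  by exists r%:A => u; rewrite mulr_algl.
by apply: sl2P => /=; rewrite !scE; ring.
Qed.

Lemma sl2_lieN (x y : sl2) : sl2_lie x y = - sl2_lie y x.
Proof.
by case: x y => [[a b] c] [[a' b'] c']; apply: sl2P => /=; ring.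
Qed.

Lemma sl2_lie_linearr (z : sl2) (r : k) (x y : sl2) :
  sl2_lie z (r *: x + y) = r *: sl2_lie z x + sl2_lie z y.
Proof. by rewrite sl2_lieN sl2_lie_linearl !(sl2_lieN z) scalerN opprD. Qed.

Lemma sl2_lie_alt (x : sl2) : sl2_lie x x = 0.
Proof. by case: x => [[a b] c]; apply: sl2P => /=; ring. Qed.

Lemma sl2_lie_jacobi (x y z : sl2) :
  sl2_lie x (sl2_lie y z) + sl2_lie y (sl2_lie z x) +
  sl2_lie z (sl2_lie x y) = 0.
Proof.
case: x y z => [[a b] c] [[a' b'] c'] [[a'' b''] c''].
by apply: sl2P => /=; ring.
Qed.

HB.instance Definition _ := Lmodule_isLieAlgebra.Build k sl2
  sl2_lie_linearl sl2_lie_linearr sl2_lie_alt sl2_lie_jacobi.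

End Sl2.

Definition lin_span (k : nzRingType) (V : lmodType k) (S : V -> Prop) (v : V) :
    Prop :=
  exists (m : nat) (c : 'I_m -> k) (s : 'I_m -> V),
    (forall i, S (s i)) /\ v = \sum_(i < m) c i *: s i.

Section LoopAlgebra.
Context (k : fieldType).

Definition loop : Type := sl2 (grpalg k int).

HB.instance Definition _ :=
  LieAlgebra.copy loop (sl2 (grpalg k int)).

Definition tpow (j : int) : grpalg k int := << j >>.

Definition e_ (j : int) : loop := (tpow j, 0, 0).
Definition f_ (j : int) : loop := (0, tpow j, 0).
Definition h_ (j : int) : loop := (0, 0, tpow j).

Lemma tpowD i j : tpow i * tpow j = tpow (i + j).
Proof. by rewrite -[LHS]/(ga_mul _ _) ga_mulUU mul1r. Qed.

Lemma lie_ef i j : lie (e_ i) (f_ j) = h_ (i + j).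
Proof. by apply: sl2P; rewrite /= -?tpowD; ring. Qed.

Lemma lie_he i j : lie (h_ i) (e_ j) = 2 *: e_ (i + j).
Proof. by rewrite scaler_nat mulr2n; apply: sl2P; rewrite /= -?tpowD; ring. Qed.

Lemma lie_hf i j : lie (h_ i) (f_ j) = - 2 *: f_ (i + j).
Proof.
by rewrite scaleNr scaler_nat mulr2n; apply: sl2P; rewrite /= -?tpowD; ring.
Qed.

Definition loopE (x : loop) : Prop := lin_span (fun y => exists j, y = e_ j) x.
Definition loopH (x : loop) : Prop := lin_span (fun y => exists j, y = h_ j) x.
Definition loopHE (x : loop) : Prop :=
  exists y z, [/\ loopH y, loopE z & x = y + z].

Definition is_M0 (M : lieModType loop) (u0 : M) : Prop :=
  is_induced loopHE (fun (_ : loop) (_ : k^o) => 0) (fun c : k^o => c *: u0).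

End LoopAlgebra.

Section Layers.
Context (k : fieldType) (M : lieModType (loop k)) (u0 : M) (n : nat).

Definition layer (v : M) : Prop := lact (h_ k 0) v = - (2 * n)%:R *: v.

Definition singular (v : M) : Prop := forall x, loopE x -> lact x v = 0.

Definition fword (chi : 'I_n -> int) : M :=
  foldr (fun i => lact (f_ k (chi i))) u0 (enum 'I_n).

(* Sym(n) permutes {0, ..., n - 1} here, hence the successor.                 *)
Definition wvec (chi : 'I_n -> int) : M :=
  \sum_(s : 'S_n) (-1) ^+ s *: fword (fun i => chi i + (s i).+1%:Z).

Definition laurent : Type := grpalg k {ffun 'I_n -> int}.

HB.instance Definition _ :=
  GRing.ComAlgebra.copy laurent (grpalg k {ffun 'I_n -> int}).

Definition zpow (i : 'I_n) (a : int) : laurent :=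
  << [ffun j => if j == i then a else 0] >>.

Definition symmetric_laurent (p : laurent) : Prop :=
  forall (s : 'S_n) (gamma : {ffun 'I_n -> int}),
    p@_[ffun i => gamma (s i)] = p@_gamma.

Definition msym (gamma : 'I_n -> int) : laurent :=
  (n`!%:R)^-1 *: \sum_(s : 'S_n) \prod_(i < n) zpow (s i) (gamma i).

Definition Omega : laurent :=
  \prod_(i < n) \prod_(j < n | (i < j)%N) (zpow i 1 - zpow j 1) ^+ 2.

(* act is the action of the algebra A_n of symmetric Laurent polynomials on   *)
(* the n-th layer; its values outside of A_n and the layer are irrelevant.    *)
Definition is_layer_action (act : laurent -> M -> M) : Prop :=
  [/\ forall p v, symmetric_laurent p -> layer v -> layer (act p v),
      forall (a : k) p q v,
        symmetric_laurent p -> symmetric_laurent q -> layer v ->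
        act (a *: p + q) v = a *: act p v + act q v,
      forall (a : k) p v w, symmetric_laurent p -> layer v -> layer w ->
        act p (a *: v + w) = a *: act p v + act p w,
      (forall v, layer v -> act 1 v = v) /\
      (forall p q v, symmetric_laurent p -> symmetric_laurent q -> layer v ->
        act (p * q) v = act p (act q v))
    & forall gamma chi : 'I_n -> int,
        act (msym gamma) (fword chi) =
        (n`!%:R)^-1 *: \sum_(s : 'S_n) fword (fun i => chi i + gamma (s i))].

Definition OmegaM (act : laurent -> M -> M) (v : M) : Prop :=
  exists2 w, layer w & v = act Omega w.

Definition H_submodule_of_layer (S : M -> Prop) : Prop :=
  [/\ forall v, S v -> layer v,
      S 0,
      forall (a : k) v w, S v -> S w -> S (a *: v + w)
    & forall x v, loopH x -> S v -> S (lact x v)].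

End Layers.

(* Main.v *)
Require Import Defs.
From mathcomp Require Import all_boot all_order all_fingroup all_algebra.
From HB Require Import structures.
From mathcomp Require Import finmap ring.

(* The induced module M(0) is realised on the free module spanned by finite   *)
(* multisets of integers, where f(a) adds the element a; hence M_n is the     *)
(* module of Sym(n)-coinvariants of the Laurent polynomials: the linear map   *)
(* F sending z^x to f(x_1)...f(x_n) u_0 maps onto M_n, and F q determines the *)
(* average of q over Sym(n). The only possible action of A_n is therefore     *)
(* p . F q = F (p q).                                                         *)
(* With V the Vandermonde product, expanding the determinant gives            *)
(* w(x) = F (V z^(x + 1)), so the span of the w(x) is F (V L), whereas        *)
(* Omega . M_n = F (V^2 L). As V is antisymmetric, F (V q) = F (V alt q), and *)
(* alt q is divisible by V; hence both spaces agree.                          *)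
(* Finally e(j) w(x) vanishes because e(j) merges two factors f(a), f(b) into *)
(* f(a + b + j), so that the terms of w(x) cancel under the transposition of  *)
(* the two merged positions.                                                  *)

(** The coinvariant picture rests on [to_fock_exists]: the elements f(s) u_0, for s a multiset, are
    linearly independent and span M(0), which does the work of the Poincare-Birkhoff-Witt theorem.
    It yields [layer_section], a linear G with G (F q) the average of q and F (G v) = v on M_n. From
    G, [layer_action_exists] builds an action of A_n, and [layer_actionE] shows that any action
    satisfies p . F q = F (p q) for symmetric p. The equality of the two spaces combines [span_wvec]
    with [vdm_mul_invariant]. Stability under H holds because h(j) acts as multiplication by -2
    (z_1^j + ... + z_n^j) ([lact_hF]), which commutes with Omega. The space is non-zero because
    Omega is symmetric, so that G recovers it from F Omega, and Omega itself does not vanish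
    ([Omega_neq0]). Singularity is [wvec_singular]. *)

Set Implicit Arguments.
Unset Strict Implicit.
Unset Printing Implicit Defensive.

Import Order.TTheory GRing.Theory Num.Theory.

Local Open Scope ring_scope.

(** * Free modules and alternants *)

Section LinearExtension.
Context (R : comNzRingType) (K : choiceType).

Lemma malgU_scale (c : R) (x : K) : << c *g x >> = c *: << x >> :> {malg R[K]}.
Proof. by apply/malgP=> y; rewrite mcoeffZ !mcoeffU mulrnAr mulr1. Qed.

Lemma malg_ind (P : {malg R[K]} -> Prop) :
  P 0 -> (forall c x v, P v -> P (c *: << x >> + v)) -> forall v, P v.
Proof.
move=> P0 PD v; rewrite (monalgE v); elim: (enum_fset _) => [|x r IHr].
  by rewrite big_nil.
by rewrite big_cons malgU_scale; apply: PD.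
Qed.

Context (W : lmodType R).

Definition lext (g : K -> W) (v : {malg R[K]}) : W :=
  \sum_(x <- msupp v) v@_x *: g x.

Lemma lextEw (g : K -> W) (d : {fset K}) (v : {malg R[K]}) :
  (msupp v `<=` d)%fset -> lext g v = \sum_(x <- d) v@_x *: g x.
Proof.
move=> le_d; rewrite /lext (big_fset_incl _ le_d) //= => x _ /mcoeff_outdom ->.
by rewrite scale0r.
Qed.

Lemma lext_linear (g : K -> W) : linear (lext g).
Proof.
move=> a u v; pose d := (msupp u `|` msupp v)%fset.
have le_d : (msupp (a *: u + v) `<=` d)%fset.
  apply: (fsubset_trans (msuppD_le _ _)).
  exact: (fsetSU _ (msuppZ_le _ _)).
rewrite (lextEw _ le_d) (lextEw _ (fsubsetUl _ _ : msupp u `<=` d)%fset).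
rewrite (lextEw _ (fsubsetUr _ _ : msupp v `<=` d)%fset).
rewrite scaler_sumr -big_split /=; apply: eq_bigr => x _.
by rewrite mcoeffD mcoeffZ scalerDl scalerA.
Qed.

HB.instance Definition _ (g : K -> W) :=
  GRing.isLinear.Build R {malg R[K]} W _ (lext g) (lext_linear g).

Lemma lextU (g : K -> W) (x : K) : lext g << x >> = g x.
Proof.
by rewrite (lextEw _ msuppU_le) big_seq_fset1 mcoeffUU scale1r.
Qed.

Lemma linear_malg_eq (f g : {linear {malg R[K]} -> W}) :
  (forall x, f << x >> = g << x >>) -> f =1 g.
Proof.
move=> fg; apply: malg_ind => [|c x v IHv]; first by rewrite !raddf0.
by rewrite !linearP fg IHv.
Qed.

End LinearExtension.

Lemma mcoeff_lext_inj (R : comNzRingType) (K L : choiceType) (h : K -> L)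
    (v : {malg R[K]}) (x : K) : injective h ->
  (lext (fun x => << h x >> : {malg R[L]}) v)@_(h x) = v@_x.
Proof.
move=> h_inj; elim/malg_ind: v => [|c y v IHv]; first by rewrite raddf0 !mcoeff0.
by rewrite linearP /= lextU !mcoeffD !mcoeffZ !mcoeffU IHv (inj_eq h_inj).
Qed.

Section GroupAlgebraExtension.
Context (R : comNzRingType) (G : zmodType).

Lemma ga_mulE (x y : G) :
  (<< x >> : grpalg R G) * (<< y >> : grpalg R G) = << x + y >>.
Proof. by rewrite -[LHS]/(ga_mul _ _) ga_mulUU mulr1. Qed.

Lemma lext_mul (B : comAlgType R) (g : G -> B) :
  {morph g : x y / x + y >-> x * y} ->
  {morph (lext g : grpalg R G -> B) : p q / p * q}.
Proof.
move=> gD p q; elim/malg_ind: p => [|c x p IHp].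
  by rewrite [0 : {malg R[G]}](_ : _ = 0 :> grpalg R G) // mul0r raddf0 mul0r.
rewrite mulrDl -scalerAl !linearP /= IHp lextU mulrDl -scalerAl.
congr (_ *: _ + _); elim/malg_ind: q {IHp} => [|d y q IHq].
  by rewrite [0 : {malg R[G]}](_ : _ = 0 :> grpalg R G) // mulr0 raddf0 mulr0.
by rewrite mulrDr -scalerAr !linearP /= IHq ga_mulE !lextU gD mulrDr -scalerAr.
Qed.
End GroupAlgebraExtension.

Section DetDivisible.
Context (R : comNzRingType).

Lemma det_poly_eval_dvd n (x : 'I_n -> R) (p : 'I_n -> {poly R}) :
  exists c, \det (\matrix_(i, j) (p j).[x i]) =
    \prod_(i < n) \prod_(j < n | (i < j)%N) (x j - x i) * c.
Proof.
(* Subtracting row 0 from row i > 0 leaves (x_i - x_0) (q_j).[x_i]; then      *)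
(* expand along row 0.                                                        *)
elim: n => [|n IHn] in x p *.
  by exists 1; rewrite det_mx00 big_ord0 mulr1.
have /fin_all_exists[q qE] j :
    exists q, p j - (p j).[x 0]%:P = q * ('X - (x 0)%:P).
  by apply/factor_theorem; rewrite /root !hornerE subrr.
have qE' i j : (p j).[x i] = (p j).[x 0] + (x i - x 0) * (q j).[x i].
  have /(congr1 (horner^~ (x i))) := qE j; rewrite !hornerE => /eqP.
  by rewrite subr_eq => /eqP ->; rewrite addrC mulrC.
(* [B] is the matrix after the row subtraction, with x_i - x_0 divided out of row i; the lower
   triangular [L] undoes both operations. *)
pose B : 'M[R]_n.+1 := \matrix_(i, j)
  if i == 0 then (p j).[x 0] else (q j).[x i].
pose L : 'M[R]_n.+1 := \matrix_(i, j)
  if j == 0 then 1 else if i == j then x i - x 0 else 0.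
have -> : (\matrix_(i, j) (p j).[x i]) = L *m B.
  apply/matrixP=> i j; rewrite !mxE big_ord_recl !mxE eqxx mul1r qE'.
  congr (_ + _); have [->|i_neq0] := eqVneq i 0.
    rewrite subrr mul0r big1 // => l _; rewrite !mxE /=.
    by rewrite mul0r.
  case: (unliftP 0 i) i_neq0 => [l ->|-> //] _.
  rewrite (bigD1 l) //= !mxE /= eqxx big1 ?addr0 // => m m_neq.
  by rewrite !mxE /= (inj_eq lift_inj) eq_sym (negbTE m_neq) mul0r.
have detL : \det L = \prod_(i < n) (x (lift 0 i) - x 0).
  rewrite det_trig; last first.
    apply/is_trig_mxP => i j lt_ij; rewrite !mxE.
    rewrite -val_eqE -[i == j]val_eqE /= gtn_eqF ?(leq_ltn_trans _ lt_ij) //.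
    by rewrite ltn_eqF.
  rewrite big_ord_recl !mxE eqxx mul1r.
  by apply: eq_bigr => i _; rewrite !mxE /= eqxx.
(* The minor of [B] without row 0 and column j evaluates the remaining quotients at the remaining
   points, so induction applies to it. *)
have /fin_all_exists[c cE] j := IHn (x \o lift 0) (q \o lift j).
exists (\sum_j (p j).[x 0] * ((-1) ^+ j * c j)).
rewrite det_mulmx detL big_ord_recl [X in X * _ * _]big_mkcond big_ord_recl /=.
rewrite mul1r -mulrA; congr (_ * _).
rewrite (expand_det_row _ 0) mulr_sumr; apply: eq_bigr => j _.
rewrite !mxE eqxx /cofactor add0n [RHS]mulrCA; congr (_ * _).
rewrite [RHS]mulrCA; congr (_ * _).
have -> : row' 0 (col' j B) =
    \matrix_(i, l) ((q \o lift j) l).[(x \o lift 0) i].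
  by apply/matrixP=> i l; rewrite !mxE.
rewrite cE; congr (_ * _); apply: eq_bigr => i _.
rewrite [RHS]big_mkcond big_ord_recl /= mul1r [LHS]big_mkcond.
by apply: eq_bigr.
Qed.
End DetDivisible.

(** * Symmetric and antisymmetric Laurent polynomials *)

Section Antisymmetrization.
Context (k : fieldType) (char0 : [pchar k] =i pred0) (n : nat).
(** Only these properties of Laurent polynomials matter: the monomials [z x] span and multiply by
    adding exponents, and [sg s] is the algebra map permuting the exponents. *)
Context (L : comAlgType k) (z : {ffun 'I_n -> int} -> L).
Hypotheses (zD : {morph z : x y / x + y >-> x * y}) (z0 : z 0 = 1).
Hypothesis z_ind : forall P : L -> Prop, P 0 ->
  (forall c x q, P q -> P (c *: z x + q)) -> forall q, P q.
Context (sg : 'S_n -> {linear L -> L}).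
Hypotheses (sgM : forall s, {morph sg s : p q / p * q})
  (sgz : forall s x, sg s (z x) = z [ffun i => x (s i)]).

Lemma sg_comp s t q : sg t (sg s q) = sg (t * s)%g q.
Proof.
elim/z_ind: q => [|c x q IHq]; first by rewrite !raddf0.
rewrite !linearP /= IHq !sgz; congr (_ *: z _ + _).
by apply/ffunP => i; rewrite !ffunE permM.
Qed.

Definition sym_avg (q : L) : L := (n`!%:R)^-1 *: \sum_(s : 'S_n) sg s q.

Lemma fact_neq0 : n`!%:R != 0 :> k.
Proof. by rewrite (proj1 (pcharf0P k) char0) -lt0n fact_gt0. Qed.

Lemma sym_avg_linear : linear sym_avg.
Proof.
move=> c p q; rewrite /sym_avg scalerA mulrC -scalerA -scalerDr; congr (_ *: _).
by rewrite scaler_sumr -big_split; apply: eq_bigr => s _; rewrite linearP.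
Qed.

HB.instance Definition _ := GRing.isLinear.Build k L L _ sym_avg sym_avg_linear.

Lemma sg_sym_avg s q : sg s (sym_avg q) = sym_avg q.
Proof.
rewrite /sym_avg linearZ /= raddf_sum /=; congr (_ *: _).
rewrite [RHS](reindex_inj (mulgI s)) /=.
by apply: eq_bigr => t _; rewrite sg_comp.
Qed.

Lemma sym_avg_invariant (W : lmodType k) (F : {linear L -> W}) q :
  (forall s p, F (sg s p) = F p) -> F (sym_avg q) = F q.
Proof.
move=> Fsg; rewrite /sym_avg linearZ /= raddf_sum /=.
under eq_bigr do rewrite Fsg.
rewrite sumr_const card_Sn -scaler_nat scalerA mulVf ?scale1r //.
exact: fact_neq0.
Qed.

Lemma sym_avg_mul p q : (forall s, sg s p = p) -> sym_avg (p * q) = p * sym_avg q.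
Proof.
move=> p_sym; rewrite /sym_avg -scalerAr mulr_sumr; congr (_ *: _).
by apply: eq_bigr => s _; rewrite sgM p_sym.
Qed.

Lemma sym_avg_id p : (forall s, sg s p = p) -> sym_avg p = p.
Proof.
move=> p_sym; rewrite /sym_avg; under eq_bigr do rewrite p_sym.
rewrite sumr_const card_Sn -scaler_nat scalerA mulVf ?scale1r //.
exact: fact_neq0.
Qed.

Definition var (i : 'I_n) (a : int) : L := z [ffun j => if j == i then a else 0].

Lemma zE x : z x = \prod_i var i (x i).
Proof.
rewrite -(big_morph z zD z0); congr z; apply/ffunP => i.
rewrite sum_ffunE (bigD1 i) //= ffunE eqxx big1 ?addr0 // => j ji.
by rewrite ffunE eq_sym (negbTE ji).
Qed.

Lemma var_exp i m : var i 1 ^+ m = var i m%:Z.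
Proof.
elim: m => [|m IHm].
  by rewrite expr0 -z0; congr z; apply/ffunP => j; rewrite !ffunE if_same.
rewrite exprS IHm -zD; congr z; apply/ffunP => j; rewrite !ffunE.
by case: ifP; rewrite ?addr0 // -[m.+1]add1n PoszD.
Qed.

(** The Vandermonde determinant in expanded form, with exponents 0, ..., n - 1; this is the shape in
    which it occurs inside [wvec]. *)
Definition vdm : L := \sum_(s : 'S_n) (-1) ^+ s *: z [ffun i => (s i)%:Z].

Lemma vdmE : vdm = \prod_(i < n) \prod_(j < n | (i < j)%N) (var j 1 - var i 1).
Proof.
have := det_Vandermonde (\row_j var j 1).
under [X in _ = X -> _]eq_bigr do under eq_bigr do rewrite !mxE.
move=> <-; rewrite -det_tr /determinant; apply: eq_bigr => s _.
rewrite scaler_sign mulr_sign -[RHS]/(if _ then _ else _).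
have -> : \prod_i (Vandermonde n (\row_j var j 1))^T i (s i) =
    z [ffun i => (s i)%:Z].
  by rewrite zE; apply: eq_bigr => i _; rewrite !mxE ffunE var_exp.
by [].
Qed.

Lemma sg_vdm s : sg s vdm = (-1) ^+ s *: vdm.
Proof.
rewrite /vdm raddf_sum /= scaler_sumr [RHS](reindex_inj (mulgI s)) /=.
apply: eq_bigr => t _; rewrite odd_permM signr_addb scalerA.
rewrite mulrA -expr2 sqrr_sign mul1r.
rewrite linearZ /= sgz; congr (_ *: z _).
by apply/ffunP => i; rewrite !ffunE permM.
Qed.

(** After multiplication by (z_1 ... z_n)^N all exponents are non-negative, and the alternant is a
    determinant det(z_i^(y_j)) covered by [det_poly_eval_dvd]. The factor is a unit and is divided
    out again. *)
Lemma alternant_vdm_dvd (x : {ffun 'I_n -> int}) :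
  exists c, \sum_(s : 'S_n) (-1) ^+ s *: z [ffun i => x (s i)] = vdm * c.
Proof.
(* Any bound on all |x_i| would do. *)
pose N := (\sum_i absz (x i))%N.
have [y yE] : exists y : {ffun 'I_n -> nat}, forall i, x i + N%:Z = (y i)%:Z.
  exists [ffun i => absz (x i + N%:Z)] => i; rewrite ffunE gez0_abs //.
  rewrite -lerBlDr sub0r lerNl; apply: le_trans (_ : `|x i| <= _).
    by rewrite -normrN ler_norm.
  by rewrite lez_nat /N (bigD1 i) //= leq_addr.
have [c cE] := det_poly_eval_dvd (fun i => var i 1) (fun j => 'X^(y j)).
exists (c * z [ffun=> - N%:Z]); rewrite mulrA vdmE -cE /determinant mulr_suml.
apply: eq_bigr => s _; rewrite scaler_sign mulr_sign.
have -> : \prod_i (\matrix_(i, j) ('X^(y j)).[var i 1]) i (s i) =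
    z [ffun i => (y (s i))%:Z].
  by rewrite zE; apply: eq_bigr => i _; rewrite !mxE hornerXn ffunE var_exp.
have -> : z [ffun i => x (s i)] = z [ffun i => (y (s i))%:Z] * z [ffun=> - N%:Z].
  by rewrite -zD; congr z; apply/ffunP => i; rewrite !ffunE -yE addrK.
by case: ifP; rewrite ?mulNr.
Qed.

(** The map F does not see averaging, and the average of V z^x is V / n! times the alternant of x,
    because V changes by sgn(s) under s. The alternant supplies the second factor V. *)
Lemma vdm_mul_invariant (W : lmodType k) (F : {linear L -> W}) q :
  (forall s p, F (sg s p) = F p) ->
  exists r, F (vdm * q) = F (vdm ^+ 2 * r).
Proof.
move=> Fsg; elim/z_ind: q => [|c x q [r rE]]; first by exists 0; rewrite !mulr0.
have [d dE] := alternant_vdm_dvd x.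
exists (c *: (n`!%:R^-1 *: d) + r).
rewrite !mulrDr -!scalerAr !linearP /= rE; congr (_ *: _ + _).
rewrite -(sym_avg_invariant _ Fsg) /sym_avg linearZ [RHS]linearZ /=.
congr (_ *: F _); rewrite expr2 -mulrA -dE mulr_sumr; apply: eq_bigr => s _.
by rewrite sgM sg_vdm sgz -scalerAl -scalerAr.
Qed.

End Antisymmetrization.

(** * A model of the induced module *)

Lemma perm_swap (T : eqType) (a b : T) s : perm_eq [:: a, b & s] [:: b, a & s].
Proof. exact: (permEl (perm_catCA [:: a] [:: b] s)). Qed.

(** Swaps at the head and congruence under cons generate all permutations: the head of [s] is
    bubbled to the front of [t]. This lets functions defined by recursion on lists descend to
    multisets. *)
Lemma perm_invariant (T : eqType) (U : Type) (g : seq T -> U) :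
  (forall a b s, g [:: a, b & s] = g [:: b, a & s]) ->
  (forall a s t, perm_eq s t -> g s = g t -> g (a :: s) = g (a :: t)) ->
  forall s t, perm_eq s t -> g s = g t.
Proof.
move=> gC gS; elim=> [|a s IHs] t; first by move/perm_size/esym/size0nil ->.
move=> st; have := perm_mem st a; rewrite mem_head => /esym/splitPr t_eq.
case: t_eq st => t1 t2; rewrite perm_sym perm_catC /= perm_cons perm_catC => st.
rewrite perm_sym in st; rewrite (gS _ _ _ st (IHs _ st)) {IHs st}.
elim: t1 => [//|b t1 IHt]; rewrite /= gC; apply: gS => //.
by rewrite -cat1s perm_catCA.
Qed.

Section Bracket.
Context (k : comNzRingType) (V : lmodType k).
Implicit Types (P Q S : int -> {linear V -> V}) (a b : grpalg k int).

(** If [P j] is the operator of x(j), this is the operator of x tensored with the Laurent polynomial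
    a. *)
Definition smear P a (v : V) : V := lext (fun j => P j v) a.

Lemma smear_linearl P v : linear (fun a => smear P a v).
Proof. by move=> c a b; rewrite /smear linearP. Qed.

Lemma smear_linearr P a : linear (smear P a).
Proof.
move=> c u v; rewrite /smear /lext scaler_sumr -big_split /=.
by apply: eq_bigr => j _; rewrite linearP scalerDr !scalerA mulrC.
Qed.

HB.instance Definition _ P a :=
  GRing.isLinear.Build k V V _ (smear P a) (smear_linearr P a).

Lemma smear0 P v : smear P 0 v = 0.
Proof. exact: raddf0. Qed.

Lemma smearU P j v : smear P << j >> v = P j v.
Proof. exact: lextU. Qed.

(** Both sides are bilinear in a and b, so a commutator needs checking on powers of t only. The
    scalar r is a structure constant of sl(2), or 0 for commuting families. *)
Lemma smear_bracket P Q S r :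
  (forall i j v, P i (Q j v) - Q j (P i v) = r *: S (i + j) v) ->
  forall a b v, smear P a (smear Q b v) - smear Q b (smear P a v) =
    r *: smear S (a * b) v.
Proof.
move=> PQ a b v; elim/malg_ind: a => [|c i a IHa].
  rewrite [0 : {malg _[_]}](_ : _ = 0 :> grpalg k int) // mul0r.
  by rewrite !smear0 raddf0 subrr scaler0.
rewrite mulrDl -scalerAl !smear_linearl scalerDr -IHa linearP /=.
rewrite opprD addrACA; congr (_ + _).
rewrite -scalerBr scalerA mulrC -scalerA; congr (_ *: _).
rewrite !smearU {IHa}; elim/malg_ind: b => [|d j b IHb].
  rewrite [0 : {malg _[_]}](_ : _ = 0 :> grpalg k int) // mulr0.
  by rewrite !smear0 raddf0 subrr scaler0.
rewrite mulrDr -scalerAr !smear_linearl scalerDr -IHb linearP /=.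
rewrite opprD addrACA; congr (_ + _).
rewrite -scalerBr scalerA mulrC -scalerA; congr (_ *: _).
by rewrite ga_mulE !smearU PQ.
Qed.

Lemma smear_comm P Q :
  (forall i j v, P i (Q j v) = Q j (P i v)) ->
  forall a b v, smear P a (smear Q b v) = smear Q b (smear P a v).
Proof.
move=> PQ a b v; apply/eqP; rewrite -subr_eq0; apply/eqP.
rewrite (@smear_bracket P Q P 0) ?scale0r // => i j w.
by rewrite PQ subrr scale0r.
Qed.

End Bracket.

Section Sl2Action.
Context (k : comNzRingType) (A : comAlgType k) (V : lmodType k).
Variables E F H : A -> V -> V.
Hypotheses (E_linearl : forall v, linear (E ^~ v))
  (F_linearl : forall v, linear (F ^~ v)) (H_linearl : forall v, linear (H ^~ v)).
Hypotheses (E_linearr : forall a, linear (E a)) 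
  (F_linearr : forall a, linear (F a))
  (H_linearr : forall a, linear (H a)).

Definition sl2_act (x : sl2 A) (v : V) : V := E x.1.1 v + F x.1.2 v + H x.2 v.

Lemma sl2_act_linearl v r x y :
  sl2_act (r *: x + y) v = r *: sl2_act x v + sl2_act y v.
Proof.
rewrite /sl2_act /= [E _ v]E_linearl [F _ v]F_linearl [H _ v]H_linearl !scalerDr.
by rewrite [X in X + _ = _]addrACA [LHS]addrACA.
Qed.

Lemma sl2_act_linearr x r v w :
  sl2_act x (r *: v + w) = r *: sl2_act x v + sl2_act x w.
Proof.
rewrite /sl2_act /= E_linearr F_linearr H_linearr !scalerDr.
by rewrite [X in X + _ = _]addrACA [LHS]addrACA.
Qed.

Hypotheses
  (EEC : forall a b v, E a (E b v) = E b (E a v))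
  (FFC : forall a b v, F a (F b v) = F b (F a v))
  (HHC : forall a b v, H a (H b v) = H b (H a v))
  (EF : forall a b v, E a (F b v) - F b (E a v) = H (a * b) v)
  (HE : forall a b v, H a (E b v) - E b (H a v) = 2 *: E (a * b) v)
  (HF : forall a b v, H a (F b v) - F b (H a v) = - 2 *: F (a * b) v).

(** Expanding both actions leaves nine commutators. The three of equal type vanish; the six mixed
    ones are, up to sign, instances of [EF], [HE] and [HF], and regroup into the components of the
    bracket. *)
Lemma sl2_act_lie x y v :
  sl2_act (lie x y) v = sl2_act x (sl2_act y v) - sl2_act y (sl2_act x v).
Proof.
have subr3 (W : zmodType) (x1 x2 x3 y1 y2 y3 : W) :
    x1 + x2 + x3 - (y1 + y2 + y3) = (x1 - y1) + (x2 - y2) + (x3 - y3).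
  by rewrite !opprD [LHS]addrACA [X in X + _ = _]addrACA.
have linD (f : V -> V) : linear f -> forall u w, f (u + w) = f u + f w.
  by move=> f_lin u w; rewrite -{1}[u]scale1r f_lin scale1r.
have linB (f : A -> V) : linear f -> forall u w, f (u - w) = f u - f w.
  by move=> f_lin u w; rewrite [u - w]addrC -[- w]scaleN1r f_lin scaleN1r addrC.
have lin2 (f : A -> V) : linear f -> forall u w, f (2 * (u - w)) = 2 *: (f u - f w).
  move=> f_lin u w; rewrite mulr_natl mulr2n -[X in X + _]scale1r f_lin.
  by rewrite linB // scale1r scaler_nat mulr2n.
have linN (f : A -> V) : linear f -> forall u, f (- u) = - f u.
  move=> f_lin u; have f0 : f 0 = 0 by rewrite -[X in f X](subrr 0) linB // subrr.
  by rewrite -[- u]add0r linB // f0 add0r.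
case: x y => [[a b] c] [[a' b'] c'].
have brr (P : A -> V -> V) d : (forall d, linear (P d)) ->
    P d (sl2_act (a', b', c') v) - sl2_act (a', b', c') (P d v) =
    (P d (E a' v) - E a' (P d v)) + (P d (F b' v) - F b' (P d v)) +
    (P d (H c' v) - H c' (P d v)).
  by move=> P_lin; rewrite /sl2_act !(linD (P d)) // subr3.
set y : sl2 A := (a', b', c').
rewrite [sl2_act (a, b, c) (sl2_act y v)]/sl2_act [sl2_act (a, b, c) v]/sl2_act.
rewrite !(linD (sl2_act y)); try by move=> r u w; apply: sl2_act_linearr.
rewrite subr3 !brr //= EEC FFC HHC !subrr EF HE HF.
rewrite -[F b (E a' v) - _]opprB -[E a (H c' v) - _]opprB.
rewrite -[F b (H c' v) - _]opprB EF HE HF.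
rewrite [sl2_act _ v]/sl2_act /= (lin2 (E^~ v)) // (linN (F^~ v)) // (lin2 (F^~ v)) //.
rewrite (linB (H^~ v)) // (mulrC c' a) (mulrC c' b) (mulrC a' b).
move: (E (c * a') v) (E (a * c') v) (F (c * b') v) (F (b * c') v) => e1 e2 f1 f2.
move: (H (a * b') v) (H (b * a') v) => h1 h2.
rewrite !(scaleNr 2) !opprK !add0r !addr0 !scalerBr opprB.
by rewrite [LHS](AC (2*2*2) ((5*2)*(6*3)*(1*4))).
Qed.

End Sl2Action.

(* The free module on the finite multisets of integers; [mm_word s] is the    *)
(* basis element attached to the multiset of the entries of [s].              *)
Record multiset_module (k : comNzRingType) := MultisetModule {
  mm_sort :> lmodType k;
  mm_word : seq int -> mm_sort;
  mm_ext : forall W : lmodType k, (seq int -> W) -> {linear mm_sort -> W};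
  mm_ind : forall P : mm_sort -> Prop, P 0 ->
    (forall c s v, P v -> P (c *: mm_word s + v)) -> forall v, P v;
  mm_word_perm : forall s t, perm_eq s t -> mm_word s = mm_word t;
  mm_extE : forall (W : lmodType k) (g : seq int -> W),
    (forall s t, perm_eq s t -> g s = g t) ->
    forall s, mm_ext g (mm_word s) = g s
}.

(** Sorted lists serve as normal forms of multisets, so the free module on them will do. *)
Lemma multiset_module_exists (k : comNzRingType) : multiset_module k.
Proof.
pose T := {s : seq int | sorted <=%O s}.
pose w s : T := exist _ (sort <=%O s) (sort_le_sorted s).
have w_perm s t : perm_eq s t -> w s = w t.
  by move=> st; apply: val_inj; apply/perm_sort_leP.
have wK (x : T) : w (val x) = x.
  by apply: val_inj; apply: sorted_sort (valP x); apply: le_trans.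
apply: (@MultisetModule k {malg k[T]} (fun s => << w s >>)
         (fun W g => lext (fun x : T => g (val x)) : {linear _ -> _})).
- move=> P P0 PD; apply: malg_ind => // c x v Pv.
  by rewrite -(wK x); apply: PD.
- by move=> s t /w_perm ->.
- move=> W g g_perm s; rewrite /= lextU /=; apply: g_perm.
  by rewrite perm_sort.
Qed.

Section Fock.
Context (k : fieldType) (X : multiset_module k).
Local Notation word := (mm_word X).

Lemma word_swap a b s : word [:: a, b & s] = word [:: b, a & s].
Proof. exact/mm_word_perm/perm_swap. Qed.

Definition fockF (a : int) : {linear X -> X} := mm_ext X (fun s => word (a :: s)).

Lemma fockF_word a s : fockF a (word s) = word (a :: s).
Proof. by apply: mm_extE => {}s t st; apply: mm_word_perm; rewrite perm_cons. Qed.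

Lemma fockFC a b v : fockF a (fockF b v) = fockF b (fockF a v).
Proof.
elim/mm_ind: v => [|c s v IHv]; first by rewrite !raddf0.
by rewrite !linearP /= IHv !fockF_word word_swap.
Qed.

Lemma fock_ind (P : X -> Prop) : P 0 ->
  (forall c v w, P v -> P w -> P (c *: v + w)) -> P (word [::]) ->
  (forall a v, P v -> P (fockF a v)) -> forall v, P v.
Proof.
move=> P0 PD Pw PF; apply: mm_ind => // c s v; apply: PD.
by elim: s => [//|a s IHs]; rewrite -fockF_word; apply: PF.
Qed.

(** Forced by [h(j), f(a)] = -2 f(a + j) and h(j) u_0 = 0: h(j) is moved past the leading factor. *)
Fixpoint fockH_word (j : int) (s : seq int) : X :=
  if s is a :: s' then
    fockF a (fockH_word j s') - 2 *: word (a + j :: s')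
  else 0.

Lemma fockH_perm j s t : perm_eq s t -> fockH_word j s = fockH_word j t.
Proof.
move: s t; apply: perm_invariant => [a b s|a s t st st_eq] /=.
  rewrite !raddfB /= ![fockF _ (_ *: _)]linearZ /= fockFC -!addrA; congr (_ + _).
  rewrite !fockF_word addrC (word_swap (a + j)).
  by rewrite (word_swap a).
by rewrite st_eq (@mm_word_perm _ X (a + j :: s) (a + j :: t)) ?perm_cons.
Qed.

Definition fockH (j : int) : {linear X -> X} := mm_ext X (fockH_word j).

Lemma fockH_wordE j s : fockH j (word s) = fockH_word j s.
Proof. by apply: mm_extE; apply: fockH_perm. Qed.

Lemma fockHF j a v :
  fockH j (fockF a v) = fockF a (fockH j v) - 2 *: fockF (a + j) v.
Proof.
elim/mm_ind: v => [|c s v IHv]; first by rewrite !raddf0 addr0.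
rewrite !linearP /= IHv addrACA -scalerDr.
by rewrite !fockF_word !fockH_wordE.
Qed.

(** This and the next two relations hold on the vacuum and are carried past each f(a) by induction;
    [fockEH] needs [fockHC] for the terms so created, and [fockEC] needs [fockEH]. *)
Lemma fockHC i j v : fockH i (fockH j v) = fockH j (fockH i v).
Proof.
elim/fock_ind: v => [|c v w IHv IHw||a v IHv].
- by rewrite !raddf0.
- by rewrite !linearP /= IHv IHw.
- by rewrite !fockH_wordE !raddf0.
rewrite !fockHF !raddfB /= ![fockH _ (_ *: _)]linearZ /= !fockHF IHv.
rewrite [a + i + j]addrAC !scalerBr !opprB [LHS]addrACA [RHS]addrACA.
by congr (_ + _); rewrite addrC.
Qed.

(** Forced by [e(j), f(a)] = h(a + j) and e(j) u_0 = 0. *)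
Fixpoint fockE_word (j : int) (s : seq int) : X :=
  if s is a :: s' then fockF a (fockE_word j s') + fockH (a + j) (word s') else 0.

Lemma fockE_perm j s t : perm_eq s t -> fockE_word j s = fockE_word j t.
Proof.
move: s t; apply: perm_invariant => [a b s|a s t st st_eq] /=.
  rewrite !linearD /= fockFC -!addrA; congr (_ + _).
  rewrite -!fockF_word !fockHF [b + (a + j)]addrCA addrA.
  exact: addrCA.
by rewrite st_eq (mm_word_perm X st).
Qed.

Definition fockE (j : int) : {linear X -> X} := mm_ext X (fockE_word j).

Lemma fockE_wordE j s : fockE j (word s) = fockE_word j s.
Proof. by apply: mm_extE; apply: fockE_perm. Qed.

Lemma fockEF j a v : fockE j (fockF a v) = fockF a (fockE j v) + fockH (a + j) v.
Proof.
elim/mm_ind: v => [|c s v IHv]; first by rewrite !raddf0 addr0.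
by rewrite !linearP /= IHv addrACA -scalerDr !fockF_word !fockE_wordE.
Qed.

Lemma fockEH i j v :
  fockE j (fockH i v) = fockH i (fockE j v) - 2 *: fockE (i + j) v.
Proof.
elim/fock_ind: v => [|c v w IHv IHw||a v IHv].
- by rewrite !raddf0 addr0.
- by rewrite !linearP /= IHv IHw addrACA -scalerDr.
- by rewrite !fockE_wordE !fockH_wordE !raddf0 addr0.
rewrite fockHF !fockEF raddfB raddfD /= ![fockE _ (_ *: _)]linearZ /=.
rewrite fockHF !fockEF IHv.
rewrite raddfB /= ![fockF _ (_ *: _)]linearZ /= !scalerDr !opprD.
rewrite [fockH i (fockH _ _)]fockHC !addrA.
by congr (_ - _); rewrite addrAC [RHS]addrAC; congr (_ + _); rewrite addrAC.
Qed.

Lemma fockEC i j v : fockE i (fockE j v) = fockE j (fockE i v).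
Proof.
elim/fock_ind: v => [|c v w IHv IHw||a v IHv].
- by rewrite !raddf0.
- by rewrite !linearP /= IHv IHw.
- by rewrite !fockE_wordE !raddf0.
rewrite !fockEF !raddfD /= !fockEF !fockEH IHv -!addrA; congr (_ + _).
by rewrite [LHS]addrCA [i + j]addrC.
Qed.

Definition fock_act : loop k -> X -> X :=
  sl2_act (smear fockE) (smear fockF) (smear fockH).

Lemma fock_act_linearl v a x y :
  fock_act (a *: x + y) v = a *: fock_act x v + fock_act y v.
Proof. by apply: sl2_act_linearl => {}v; apply: smear_linearl. Qed.

Lemma fock_act_linearr x a v w :
  fock_act x (a *: v + w) = a *: fock_act x v + fock_act x w.
Proof. by apply: sl2_act_linearr => b; apply: smear_linearr. Qed.

Lemma fock_act_lie x y v :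
  fock_act (lie x y) v = fock_act x (fock_act y v) - fock_act y (fock_act x v).
Proof.
apply: sl2_act_lie => [{}v|{}v|{}v|a|a|a|||||a b w|a b w].
- exact: smear_linearl.
- exact: smear_linearl.
- exact: smear_linearl.
- exact: smear_linearr.
- exact: smear_linearr.
- exact: smear_linearr.
- exact: smear_comm fockEC.
- exact: smear_comm fockFC.
- exact: smear_comm fockHC.
- move=> a b w; rewrite -[RHS]scale1r; apply: smear_bracket => i j {}w.
  by rewrite fockEF scale1r addrAC subrr add0r [j + i]addrC.
- by apply: smear_bracket => i j {}w; rewrite fockEH opprB addrC subrK.
- apply: smear_bracket => i j {}w.
  by rewrite fockHF [j + i]addrC addrAC subrr add0r scaleNr.
Qed.

Definition fock : Type := X.

HB.instance Definition _ := GRing.Lmodule.on fock.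
HB.instance Definition _ := Lmodule_isLieModule.Build k (loop k) fock
  fock_act_linearl fock_act_linearr fock_act_lie.

End Fock.

(** * Lowering words in a loop module *)

HB.instance Definition _ (k : comNzRingType) (g : lieAlgType k)
    (M : lieModType g) (x : g) :=
  GRing.isLinear.Build k M M _ (@lact k g M x) (lact_linearr x).

Section LoopModule.
Context (k : fieldType) (M : lieModType (loop k)).
Implicit Types (v w : M) (j a b : int).

Lemma lact0l v : lact (0 : loop k) v = 0.
Proof.
have := lact_linearl v 1 0 (0 : loop k); rewrite scaler0 addr0 scale1r.
by move/esym/eqP; rewrite -subr_eq0 addrK => /eqP.
Qed.

Lemma lie_ff (i j : int) : lie (f_ k i) (f_ k j) = 0.
Proof. by apply: sl2P => /=; ring. Qed.

Lemma lact_ffC a b v :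
  lact (f_ k a) (lact (f_ k b) v) = lact (f_ k b) (lact (f_ k a) v).
Proof.
by apply/eqP; rewrite -subr_eq0 -lact_lie lie_ff lact0l.
Qed.

Lemma lact_scalel c (x : loop k) v : lact (c *: x) v = c *: lact x v.
Proof. by rewrite -[c *: x]addr0 lact_linearl lact0l addr0. Qed.

Lemma lact_addl (x y : loop k) v : lact (x + y) v = lact x v + lact y v.
Proof. by rewrite -{1}[x]scale1r lact_linearl scale1r. Qed.

Lemma lact_hf j a v : lact (h_ k j) (lact (f_ k a) v) =
  lact (f_ k a) (lact (h_ k j) v) - 2 *: lact (f_ k (a + j)) v.
Proof.
have /eqP := lact_lie (h_ k j) (f_ k a) v; rewrite lie_hf lact_scalel scaleNr.
by rewrite eq_sym subr_eq => /eqP ->; rewrite addrC [j + a]addrC.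
Qed.

Lemma lact_ef j a v : lact (e_ k j) (lact (f_ k a) v) =
  lact (f_ k a) (lact (e_ k j) v) + lact (h_ k (a + j)) v.
Proof.
have /eqP := lact_lie (e_ k j) (f_ k a) v; rewrite lie_ef.
by rewrite eq_sym subr_eq => /eqP ->; rewrite addrC [j + a]addrC.
Qed.

Lemma lact_tripleE (x : loop k) v : lact x v =
  lext (fun j => lact (e_ k j) v) x.1.1 + lext (fun j => lact (f_ k j) v) x.1.2
  + lext (fun j => lact (h_ k j) v) x.2.
Proof.
case: x => [[a b] c] /=.
have -> : ((a, b, c) : loop k) =
    ((a, 0, 0) : loop k) + ((0, b, 0) : loop k) + ((0, 0, c) : loop k).
  by apply: sl2P => /=; rewrite ?add0r ?addr0.
rewrite !lact_addl; congr (_ + _ + _).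
- elim/malg_ind: a => [|r j a IHa]; first by rewrite raddf0 lact0l.
  rewrite linearP /= lextU -IHa -lact_linearl; congr lact.
  by apply: sl2P => /=; rewrite ?scaler0 ?addr0.
- elim/malg_ind: b => [|r j b IHb]; first by rewrite raddf0 lact0l.
  rewrite linearP /= lextU -IHb -lact_linearl; congr lact.
  by apply: sl2P => /=; rewrite ?scaler0 ?addr0.
elim/malg_ind: c => [|r j c IHc]; first by rewrite raddf0 lact0l.
rewrite linearP /= lextU -IHc -lact_linearl; congr lact.
by apply: sl2P => /=; rewrite ?scaler0 ?addr0.
Qed.

Lemma lact_loopE v : (forall j, lact (e_ k j) v = 0) -> singular v.
Proof.
move=> ev0 _ [m [c [s [sP ->]]]].
elim/big_rec: _ => [|i x _ x0]; first exact: lact0l.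
by rewrite lact_linearl x0 addr0; have [j ->] := sP i; rewrite ev0 scaler0.
Qed.

Lemma lact_loopH (x : loop k) v : loopH x ->
  lin_span (fun w => exists j, w = lact (h_ k j) v) (lact x v).
Proof.
move=> [m [c [s [sP ->]]]].
exists m, c, (fun i => lact (s i) v); split=> [i|].
  by have [j ->] := sP i; exists j.
elim/big_rec2: _ => [|i w z _ <-]; first exact: lact0l.
exact: lact_linearl.
Qed.

Context (u0 : M).

Definition fseq (s : seq int) : M := foldr (fun a => lact (f_ k a)) u0 s.

Lemma fseq_perm s t : perm_eq s t -> fseq s = fseq t.
Proof.
move: s t; apply: perm_invariant => [a b s|a s t _] /=; first exact: lact_ffC.
by move=> ->.
Qed.

Lemma fwordE n (chi : 'I_n -> int) :
  fword u0 chi = fseq [seq chi i | i <- enum 'I_n].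
Proof. by rewrite /fword /fseq foldr_map. Qed.

Hypothesis hu0 : forall j, lact (h_ k j) u0 = 0.

(** The factors are indexed by a duplicate-free [r] because the values [chi i] may coincide;
    [rem i r] then deletes exactly the factor at i. *)
Lemma lact_h_fseq (I : eqType) (chi : I -> int) j r : uniq r ->
  lact (h_ k j) (fseq (map chi r)) =
  - 2 *: \sum_(i <- r) fseq (chi i + j :: [seq chi l | l <- rem i r]).
Proof.
elim: r => [|a r IHr] /=; first by rewrite big_nil scaler0.
case/andP=> ar r_uniq; rewrite lact_hf IHr // linearZ /= big_cons eqxx scalerDr.
rewrite addrC !scaleNr; congr (_ + _).
congr (- (_ *: _)); rewrite raddf_sum /=; apply: eq_big_seq => i ir.
have /negbTE -> : a != i by apply: contra ar => /eqP ->.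
by rewrite /= lact_ffC.
Qed.

Lemma lact_h_fword n (chi : 'I_n -> int) j :
  lact (h_ k j) (fword u0 chi) =
  - 2 *: \sum_i fword u0 (fun l => chi l + if l == i then j else 0).
Proof.
rewrite fwordE lact_h_fseq ?enum_uniq //; congr (_ *: _).
rewrite [in LHS]big_enum; apply: eq_bigr => i _; rewrite fwordE; apply: fseq_perm.
rewrite perm_sym.
have /(perm_map (fun l => chi l + if l == i then j else 0)) :
    perm_eq (enum 'I_n) (i :: rem i (enum 'I_n)).
  by rewrite perm_to_rem ?mem_enum.
move/perm_trans; apply; rewrite /= eqxx perm_cons.
rewrite (@eq_in_map _ _ _ chi _).1 // => l.
by rewrite mem_rem_uniq ?enum_uniq // inE => /andP[/negbTE -> _]; rewrite addr0.
Qed.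

Lemma lact_h0_fseq s : lact (h_ k 0) (fseq s) = - (2 * size s)%:R *: fseq s.
Proof.
elim: s => [|a s IHs] /=; first by rewrite hu0 oppr0 scale0r.
rewrite lact_hf IHs linearZ /= addr0 -scaleNr -scalerDl.
by rewrite -opprD -natrD addnC -mulnS.
Qed.

Hypothesis eu0 : forall j, lact (e_ k j) u0 = 0.

(** Moving e(j) past f(chi a) creates h(chi a + j), which by [lact_h_fseq] merges a with each later
    factor with coefficient -2. Summing over ordered pairs turns this into -1. *)
Lemma lact_e_fseq (I : eqType) (chi : I -> int) j r : uniq r ->
  lact (e_ k j) (fseq (map chi r)) =
  - \sum_(i <- r) \sum_(l <- rem i r)
      fseq (chi i + chi l + j :: [seq chi m | m <- rem l (rem i r)]).
Proof.
elim: r => [|a r IHr] /=; first by rewrite big_nil oppr0.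
case/andP=> ar r_uniq; rewrite lact_ef IHr // lact_h_fseq // raddfN raddf_sum /=.
rewrite big_cons eqxx.
have -> : \sum_(i <- r) \sum_(l <- (if a == i then r else a :: rem i r))
      fseq (chi i + chi l + j
        :: [seq chi m | m <- rem l (if a == i then r else a :: rem i r)]) =
    \sum_(i <- r) fseq (chi a + chi i + j :: [seq chi m | m <- rem i r]) +
    \sum_(i <- r) lact (f_ k (chi a)) (\sum_(l <- rem i r)
      fseq (chi i + chi l + j :: [seq chi m | m <- rem l (rem i r)])).
  rewrite -big_split /=; apply: eq_big_seq => i ir.
  have /negbTE -> : a != i by apply: contra ar => /eqP ->.
  rewrite big_cons /= eqxx [chi i + _]addrC; congr (_ + _).
  rewrite raddf_sum; apply: eq_big_seq => l; rewrite mem_rem_uniq // inE.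
  case/andP=> _ lr; have /negbTE -> : a != l by apply: contra ar => /eqP ->.
  by rewrite /= lact_ffC.
rewrite addrA [RHS]opprD [RHS]addrC; congr (_ + _).
(* The coefficient 2 is shared between the ordered pairs (a, i) and (i, a). *)
rewrite scaleNr scaler_nat mulr2n; congr (- (_ + _)); apply: eq_bigr => i _;
  by rewrite addrAC addrC [chi a + _]addrC.
Qed.

End LoopModule.

Lemma natr_inj_pchar0 (R : idomainType) : [pchar R] =i pred0 ->
  injective (fun m => m%:R : R).
Proof.
move=> /pcharf0P char0.
have natr_le m n : (m <= n)%N -> m%:R = n%:R :> R -> m = n.
  move=> mn /eqP; rewrite eq_sym -subr_eq0 -natrB // char0 subn_eq0 => nm.
  by apply/eqP; rewrite eqn_leq mn.
move=> m n; case: (leqP m n) => [|/ltnW] le_mn eq_mn; first exact: natr_le.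
exact/esym/natr_le.
Qed.

(** * Comparison of M(0) with the multiset model *)

Section InducedModule.
Context (k : fieldType) (M : lieModType (loop k)) (u0 : M) (M0 : is_M0 u0).

Lemma loopHE_h j : loopHE (h_ k j).
Proof.
exists (h_ k j), 0; split; last by rewrite addr0.
  by exists 1, (fun=> 1), (fun=> h_ k j); split;
    [exists j | rewrite big_ord1 scale1r].
by exists 0, (fun=> 0), (fun=> 0); split; [case | rewrite big_ord0].
Qed.

Lemma loopHE_e j : loopHE (e_ k j).
Proof.
exists 0, (e_ k j); split; last by rewrite add0r.
  by exists 0, (fun=> 0), (fun=> 0); split; [case | rewrite big_ord0].
by exists 1, (fun=> 1), (fun=> e_ k j); split;
    [exists j | rewrite big_ord1 scale1r].
Qed.

Lemma loopHE_u0 x : loopHE x -> lact x u0 = 0.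
Proof.
move=> xHE; have [[_ /(_ x (1 : k^o) xHE) /= iota_lact] _] := M0.
by rewrite -[u0]scale1r -iota_lact; apply: scale0r.
Qed.

Context (X : multiset_module k).

Definition of_fock : {linear X -> M} := mm_ext X (fseq u0).

Lemma of_fock_word s : of_fock (mm_word X s) = fseq u0 s.
Proof. by apply: mm_extE; apply: fseq_perm. Qed.

Lemma of_fockF a v : of_fock (fockF X a v) = lact (f_ k a) (of_fock v).
Proof.
elim/mm_ind: v => [|c s v IHv]; first by rewrite !raddf0.
by rewrite !linearP /= fockF_word !of_fock_word IHv.
Qed.

Lemma of_fockH j v : of_fock (fockH X j v) = lact (h_ k j) (of_fock v).
Proof.
elim/fock_ind: v => [|c v w IHv IHw||a v IHv].
- by rewrite !raddf0.
- by rewrite !linearP /= IHv IHw.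
- by rewrite fockH_wordE of_fock_word /= raddf0 loopHE_u0 //; apply: loopHE_h.
rewrite fockHF raddfB /= ![of_fock (_ *: _)]linearZ /= !of_fockF IHv.
by rewrite lact_hf.
Qed.

Lemma of_fockE j v : of_fock (fockE X j v) = lact (e_ k j) (of_fock v).
Proof.
elim/fock_ind: v => [|c v w IHv IHw||a v IHv].
- by rewrite !raddf0.
- by rewrite !linearP /= IHv IHw.
- by rewrite fockE_wordE of_fock_word /= raddf0 loopHE_u0 //; apply: loopHE_e.
by rewrite fockEF raddfD /= !of_fockF of_fockH IHv lact_ef.
Qed.

Lemma of_fock_lact (x : loop k) (v : fock X) :
  of_fock (lact x v) = lact x (of_fock v).
Proof.
rewrite [RHS]lact_tripleE -[lact x v]/(fock_act x v) /fock_act /sl2_act !raddfD /=.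
congr (_ + _ + _); rewrite /smear /lext raddf_sum; apply: eq_bigr => j _;
  rewrite /= linearZ /=.
- by rewrite of_fockE.
- by rewrite of_fockF.
- by rewrite of_fockH.
Qed.

Lemma fock_loopHE x : loopHE x -> lact x (mm_word X [::] : fock X) = 0.
Proof.
have h0 j : lact (h_ k j) (mm_word X [::] : fock X) = 0.
  rewrite -[lact _ _]/(fock_act _ _) /fock_act /sl2_act /= /smear !raddf0 lextU.
  by rewrite fockH_wordE !add0r.
have e0 j : lact (e_ k j) (mm_word X [::] : fock X) = 0.
  rewrite -[lact _ _]/(fock_act _ _) /fock_act /sl2_act /= /smear !raddf0 lextU.
  by rewrite fockE_wordE !addr0.
move=> [y [z [[m [c [s [sP ->]]]] [m' [c' [s' [sP' ->]]]] ->]]].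
have zE : loopE (\sum_(i < m') c' i *: s' i) by exists m', c', s'.
rewrite lact_addl (lact_loopE e0 zE) addr0.
elim/big_rec: _ => [|i w _ w0]; first exact: lact0l.
by rewrite lact_linearl w0 addr0; have [j ->] := sP i; rewrite h0 scaler0.
Qed.

(** The universal property of M(0) sends u_0 to the empty word of the model, which H + E
    annihilates. Hence distinct multisets give linearly independent elements of M(0), and these span
    it. *)
Lemma to_fock_exists : exists psi : {linear M -> X},
  (forall s, psi (fseq u0 s) = mm_word X s) /\ cancel psi of_fock.
Proof.
have [_ univ] := M0.
have [|psi [[psi_lin psi_lact] psi_u0 _]] :=
    univ (fock X) (fun c : k^o => c *: mm_word X [::]).
  split=> [c x y|x w xHE]; first by rewrite scalerDl -scalerA.
  by rewrite scale0r linearZ /= fock_loopHE ?scaler0.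
pose psiP := GRing.isLinear.Build k M X _ psi psi_lin.
pose psil : {linear M -> X} := HB.pack psi psiP.
exists psil; split.
  elim=> [|a s IHs] /=; first by rewrite -[u0]scale1r psi_u0 scale1r.
  rewrite psi_lact -fockF_word -IHs -[lact _ _]/(fock_act _ _) /fock_act /sl2_act /=.
  by rewrite /smear !raddf0 add0r addr0 lextU.
(* Both the identity and [of_fock \o psi] are g-linear and fix u_0, so the uniqueness part of the
   universal property identifies them. *)
move=> v; have [iota_hom _] := M0.
have [psi0 [_ _ uniq0]] := univ M (fun c : k^o => c *: u0) iota_hom.
have id_v : v = psi0 v by apply: (uniq0 id); split.
rewrite [RHS]id_v; apply: (uniq0 (of_fock \o psi)) => [|c].
  split=> [a x y|x w /=]; first by rewrite /= psi_lin linearP.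
  by rewrite psi_lact of_fock_lact.
by rewrite /= psi_u0 linearZ /= of_fock_word.
Qed.

Definition fock_proj m : {linear X -> X} :=
  mm_ext X (fun s => if size s == m then mm_word X s else 0).

Lemma fock_proj_word m s :
  fock_proj m (mm_word X s) = if size s == m then mm_word X s else 0.
Proof.
by apply: mm_extE => s1 s2 st; rewrite (perm_size st) (mm_word_perm X st).
Qed.

(** Asking for all large N' lets the induction merge two bounds, and lets [fock_proj_layer] take a
    range that contains n. *)
Lemma fock_proj_sum v : exists N, forall N', (N <= N')%N ->
  v = \sum_(m < N') fock_proj m v.
Proof.
elim/mm_ind: v => [|c s v [N vE]].
  by exists 0%N => N' _; rewrite big1 // => m _; rewrite raddf0.
exists (maxn (size s).+1 N) => N'; rewrite geq_max => /andP[sN' NN'].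
under eq_bigr do rewrite linearP fock_proj_word.
rewrite big_split /= -vE // -scaler_sumr (bigD1 (Ordinal sN')) //= eqxx.
rewrite big1 ?addr0 // => m; rewrite -val_eqE /= eq_sym => /negbTE ->.
by [].
Qed.

Lemma fockH0_word s : fockH X 0 (mm_word X s) = - (2 * size s)%:R *: mm_word X s.
Proof.
rewrite fockH_wordE; elim: s => [|a s IHs] /=; first by rewrite oppr0 scale0r.
rewrite IHs linearZ /= fockF_word addr0 -scaleNr -scalerDl.
by rewrite -opprD -natrD addnC -mulnS.
Qed.

Lemma fock_proj_h0 m v :
  fock_proj m (fockH X 0 v) = - (2 * m)%:R *: fock_proj m v.
Proof.
elim/mm_ind: v => [|c s v IHv]; first by rewrite !raddf0.
rewrite !linearP /= IHv; congr (_ *: _ + _).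
rewrite fockH0_word linearZ /= fock_proj_word.
by case: eqP => [->//|_]; rewrite !scaler0.
Qed.

(** On words of length m, h(0) acts as -2m, and these eigenvalues are distinct in characteristic
    zero. *)
Lemma fock_proj_layer n v : [pchar k] =i pred0 ->
  fockH X 0 v = - (2 * n)%:R *: v -> fock_proj n v = v.
Proof.
move=> char0 h0v.
have proj0 m : m != n -> fock_proj m v = 0.
  move=> mn; apply/eqP; have /eqP := fock_proj_h0 m v.
  rewrite h0v linearZ /= -subr_eq0 -scalerBl scaler_eq0 => /orP[|//].
  rewrite subr_eq0 eqr_opp => /eqP /(natr_inj_pchar0 char0)/eqP.
  by rewrite eqn_mul2l /= eq_sym (negbTE mn).
have [N vE] := fock_proj_sum v.
have nN : (n < maxn n.+1 N)%N by rewrite leq_max ltnSn.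
rewrite [RHS](vE _ (leq_maxr n.+1 N)) (bigD1 (Ordinal nN)) //= big1 ?addr0 //.
by move=> m; rewrite -val_eqE /= => mn; rewrite proj0.
Qed.
End InducedModule.

(** * The vectors w(chi) and the action of H in terms of Laurent polynomials *)

Section FWords.
Context (k : fieldType) (char0 : [pchar k] =i pred0).
Context (M : lieModType (loop k)) (u0 : M) (M0 : is_M0 u0) (n : nat).

Lemma eq_fword (chi chi' : 'I_n -> int) :
  chi =1 chi' -> fword u0 chi = fword u0 chi'.
Proof. by move=> eq_chi; rewrite !fwordE (eq_map eq_chi). Qed.

Lemma fword_perm (s : 'S_n) (chi : 'I_n -> int) :
  fword u0 (fun i => chi (s i)) = fword u0 chi.
Proof.
rewrite !fwordE (map_comp chi s); apply/fseq_perm/perm_map/uniq_perm.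
- by rewrite map_inj_uniq ?enum_uniq //; apply: perm_inj.
- exact: enum_uniq.
move=> i; rewrite mem_enum; apply/mapP; exists (s^-1%g i); rewrite ?mem_enum //.
by rewrite permKV.
Qed.

Lemma lact_h_u0 j : lact (h_ k j) u0 = 0.
Proof. by apply: (loopHE_u0 M0); apply: loopHE_h. Qed.

Lemma lact_e_u0 j : lact (e_ k j) u0 = 0.
Proof. by apply: (loopHE_u0 M0); apply: loopHE_e. Qed.

Lemma wvec_singular (chi : 'I_n -> int) : singular (wvec u0 chi).
Proof.
apply: lact_loopE => j; rewrite /wvec raddf_sum /=.
pose x (s : 'S_n) i : int := chi i + (s i).+1%:Z.
pose T i l (s : 'S_n) : M := (-1) ^+ s *:
  fseq u0 (x s i + x s l + j :: [seq x s m | m <- rem l (rem i (enum 'I_n))]).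
have Te (s : 'S_n) : lact (e_ k j) ((-1) ^+ s *: fword u0 (x s)) =
    - \sum_(i <- enum 'I_n) \sum_(l <- rem i (enum 'I_n)) T i l s.
  rewrite linearZ /= fwordE (lact_e_fseq lact_h_u0 lact_e_u0) ?enum_uniq //.
  rewrite scalerN scaler_sumr; congr (- _); apply: eq_bigr => i _.
  by rewrite scaler_sumr.
rewrite (eq_bigr _ (fun s _ => Te s)) sumrN exchange_big big1_seq ?oppr0 // => i _.
rewrite exchange_big big1_seq // => l.
rewrite mem_rem_uniq ?enum_uniq // inE => /and3P[_ li _].
(* Exchanging s(i) and s(l) flips the sign of s, but keeps s(i) + s(l), hence the merged factor, and
   all factors at other positions. *)
have TN : \sum_s T i l s = - \sum_s T i l s.
  rewrite [LHS](reindex_inj (mulgI (tperm i l))) -sumrN; apply: eq_bigr => s _.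
  rewrite /T odd_permM odd_tperm eq_sym li signr_addb mulN1r scaleNr.
  congr (- (_ *: fseq _ (_ :: _))).
    by rewrite /x !permM tpermL tpermR; ring.
  apply/eq_in_map => m; rewrite mem_rem_uniq ?rem_uniq ?enum_uniq // inE => /andP[ml].
  rewrite mem_rem_uniq ?enum_uniq // inE => /andP[mi _].
  by rewrite /x permM tpermD // eq_sym.
have /eqP : 2%:R *: \sum_s T i l s = 0.
  by rewrite scaler_nat mulr2n {2}TN subrr.
by rewrite scaler_eq0 (proj1 (pcharf0P k) char0) => /eqP.
Qed.

Context (L : comAlgType k) (z : {ffun 'I_n -> int} -> L).
Hypotheses (zD : {morph z : x y / x + y >-> x * y}) (z0 : z 0 = 1).
Hypothesis z_ind : forall P : L -> Prop, P 0 ->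
  (forall c x q, P q -> P (c *: z x + q)) -> forall q, P q.
Context (sg : 'S_n -> {linear L -> L}).
Hypotheses (sgM : forall s, {morph sg s : p q / p * q})
  (sgz : forall s x, sg s (z x) = z [ffun i => x (s i)]).
Context (F : {linear L -> M}).
Hypothesis Fz : forall x, F (z x) = fword u0 x.

Lemma F_sg s q : F (sg s q) = F q.
Proof.
elim/z_ind: q => [|c x q IHq]; first by rewrite !raddf0.
rewrite !linearP /= IHq sgz !Fz; congr (_ *: _ + _).
rewrite -(fword_perm s x); apply: eq_fword => i; exact: ffunE.
Qed.

(** By the Leibniz rule h(j) raises one exponent at a time by j, that is, it multiplies by a power
    sum. Multiplications commute, so F (Omega L) is stable under H. *)
Lemma lact_hF j q : lact (h_ k j) (F q) = F ((- 2 *: \sum_i var z i j) * q).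
Proof.
elim/z_ind: q => [|c x q IHq]; first by rewrite mulr0 !raddf0.
rewrite mulrDr -scalerAr !linearP /= IHq; congr (_ *: _ + _).
rewrite Fz (lact_h_fword lact_h_u0) -scalerAl linearZ /=; congr (_ *: _).
rewrite mulr_suml raddf_sum /=; apply: eq_bigr => i _.
rewrite -zD Fz; apply: eq_fword => l; rewrite !ffunE addrC.
by [].
Qed.

Lemma F_layer q : layer n (F q).
Proof.
rewrite /layer; elim/z_ind: q => [|c x q IHq]; first by rewrite !raddf0.
rewrite !linearP /= IHq; congr (_ *: _ + _).
by rewrite Fz fwordE (lact_h0_fseq lact_h_u0) size_map size_enum_ord.
Qed.

(** The shift by 1 reconciles Sym(n) permuting {1, ..., n} in w(chi) with the exponents of [vdm],
    which start at 0. *)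
Lemma wvecE (chi : {ffun 'I_n -> int}) :
  wvec u0 chi = F (vdm z * z (chi + [ffun=> 1])).
Proof.
rewrite /vdm mulr_suml raddf_sum /=; apply: eq_bigr => s _.
rewrite -scalerAl linearZ /= -zD Fz; congr (_ *: _); apply: eq_fword => i.
by rewrite !ffunE [RHS]addrCA -[(s i).+1]addn1 PoszD.
Qed.

Lemma span_wvec v :
  lin_span (fun w => exists chi : 'I_n -> int, w = wvec u0 chi) v <->
  exists q, v = F (vdm z * q).
Proof.
have wvec_ext (chi chi' : 'I_n -> int) : chi =1 chi' -> wvec u0 chi = wvec u0 chi'.
  move=> eq_chi; apply: eq_bigr => s _; congr (_ *: _); apply: eq_fword => i.
  by rewrite eq_chi.
split=> [[m [c [s [sP ->]]]]|[q ->]].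
  elim/big_rec: _ => [|i _ _ [q ->]]; first by exists 0; rewrite mulr0 raddf0.
  have [chi ->] := sP i.
  exists (c i *: z ([ffun l => chi l] + [ffun=> 1]) + q).
  rewrite mulrDr -scalerAr linearP /= -wvecE.
  by congr (_ *: _ + _); apply: wvec_ext => l; rewrite ffunE.
elim/z_ind: q => [|c x q [m [d [s [sP sE]]]]].
  rewrite mulr0 raddf0; exists 0%N, (fun=> 0), (fun=> 0).
  by split; [case | rewrite big_ord0].
pose chi : {ffun 'I_n -> int} := x - [ffun=> 1].
exists m.+1, (fun i => oapp d c (unlift ord0 i)),
  (fun i => oapp s (wvec u0 chi) (unlift ord0 i)); split=> [i|].
  by case: unliftP => [l _|_] /=; [apply: sP | exists chi].
rewrite big_ord_recl unlift_none /= wvecE subrK mulrDr -scalerAr linearP /= sE.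
by congr (_ + _); apply: eq_bigr => i _; rewrite liftK.
Qed.

End FWords.

(** * The action on a layer *)

Section Laurent.
Context (k : fieldType) (n : nat).
Local Notation L := (laurent k n).

Definition zmon (x : {ffun 'I_n -> int}) : L := << x >>.

Lemma zmonD : {morph zmon : x y / x + y >-> x * y}.
Proof. by move=> x y; rewrite /zmon -ga_mulE. Qed.

Lemma zmon0 : zmon 0 = 1.
Proof. by []. Qed.

Lemma zmon_ind (P : L -> Prop) : P 0 ->
  (forall c x q, P q -> P (c *: zmon x + q)) -> forall q, P q.
Proof. exact: malg_ind. Qed.

Lemma zmon_linear_eq (W : lmodType k) (f g : {linear L -> W}) :
  (forall x, f (zmon x) = g (zmon x)) -> f =1 g.
Proof. exact: linear_malg_eq. Qed.

Definition zext (W : lmodType k) (g : {ffun 'I_n -> int} -> W) : {linear L -> W} :=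
  lext g : {linear {malg k[{ffun 'I_n -> int}]} -> W}.

Lemma zextE (W : lmodType k) (g : {ffun 'I_n -> int} -> W) x : zext g (zmon x) = g x.
Proof. exact: lextU. Qed.

Lemma zextM (B : comAlgType k) (g : {ffun 'I_n -> int} -> B) :
  {morph g : x y / x + y >-> x * y} -> {morph zext g : p q / p * q}.
Proof. by move=> gD p q; apply: lext_mul. Qed.

Definition perm_var (s : 'S_n) : {linear L -> L} :=
  zext (fun x => zmon [ffun i => x (s i)]).

Lemma perm_varE s x : perm_var s (zmon x) = zmon [ffun i => x (s i)].
Proof. exact: zextE. Qed.

Lemma perm_varM s : {morph perm_var s : p q / p * q}.
Proof.
apply: zextM => x y; rewrite -zmonD; congr zmon.
by apply/ffunP => i; rewrite !ffunE.
Qed.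

Lemma perm_var_coeff (s : 'S_n) (p : L) (x : {ffun 'I_n -> int}) :
  (perm_var s p)@_[ffun i => x (s i)] = p@_x.
Proof.
apply: (@mcoeff_lext_inj k _ _ (fun x : {ffun 'I_n -> int} => [ffun i => x (s i)])).
move=> y y' /ffunP yy'; apply/ffunP => i.
by have := yy' (s^-1%g i); rewrite !ffunE permKV.
Qed.

Lemma symmetric_laurentP (p : L) :
  symmetric_laurent p <-> forall s, perm_var s p = p.
Proof.
split=> [p_sym s|p_sym s x]; last by rewrite -{1}(p_sym s) perm_var_coeff.
apply/malgP => x; have -> : x = [ffun i => [ffun j => x (s^-1%g j)] (s i)].
  by apply/ffunP => i; rewrite !ffunE permK.
by rewrite perm_var_coeff (p_sym s).
Qed.

Lemma zpowE i a : zpow k i a = var zmon i a.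
Proof. by []. Qed.

Lemma OmegaE : Omega k n = vdm zmon ^+ 2.
Proof.
rewrite (vdmE zmonD zmon0) /Omega -prodrXl; apply: eq_bigr => i _.
rewrite -prodrXl; apply: eq_bigr => j _.
by rewrite !zpowE -sqrrN opprB.
Qed.

Lemma msymE (x : {ffun 'I_n -> int}) : msym k x = sym_avg perm_var (zmon x).
Proof.
rewrite /msym /sym_avg; congr (_ *: _).
(* [msym] permutes the variables and [perm_var] the exponents; the two differ by inverting s. *)
rewrite (reindex_inj (@invg_inj _)); apply: eq_bigr => s _.
rewrite perm_varE (zE zmonD zmon0) [RHS](reindex_inj (@perm_inj _ s^-1%g)).
by apply: eq_bigr => i _; rewrite ffunE permKV zpowE.
Qed.

Lemma Omega_sym s : perm_var s (Omega k n) = Omega k n.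
Proof.
rewrite OmegaE expr2 perm_varM !(sg_vdm perm_varE) -scalerAl -scalerAr scalerA.
by rewrite -expr2 sqrr_sign scale1r.
Qed.

Lemma Omega_neq0 : [pchar k] =i pred0 -> Omega k n != 0.
Proof.
move=> char0.
(* Evaluation at z_i = i + 1: in characteristic zero these values are non-zero, as negative
   exponents require, and pairwise distinct, so no factor of Omega vanishes. *)
pose g (x : {ffun 'I_n -> int}) : k^o := \prod_(i < n) (i.+1%:R : k) ^ x i.
have natS_neq0 m : m.+1%:R != 0 :> k by rewrite (proj1 (pcharf0P k) char0).
have gD : {morph g : x y / x + y >-> x * y}.
  move=> x y; rewrite /g -big_split; apply: eq_bigr => i _.
  by rewrite ffunE expfzDr.
have gM := zextM gD.
have g1 : zext g 1 = 1.
  by rewrite -zmon0 zextE /g big1 // => i _; rewrite ffunE expr0z.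
have g_var i : zext g (var zmon i 1) = i.+1%:R.
  rewrite zextE /g (bigD1 i) //= ffunE eqxx expr1z big1 ?mulr1 // => j ji.
  by rewrite ffunE (negbTE ji) expr0z.
apply/eqP => Om0; have : zext g (Omega k n) = 0 by rewrite Om0 raddf0.
rewrite OmegaE expr2 gM.
rewrite (vdmE zmonD zmon0) (big_morph _ gM g1) => /eqP.
rewrite mulf_eq0 orbb => /prodf_eq0 [i _]; rewrite (big_morph _ gM g1).
move/prodf_eq0 => [j ij]; rewrite raddfB /= !g_var subr_eq0 => /eqP.
by move/(natr_inj_pchar0 char0) => [ji]; rewrite ji ltnn in ij.
Qed.

End Laurent.

Arguments perm_var {k n} s.

Section Layer.
Context (k : fieldType) (char0 : [pchar k] =i pred0).
Context (M : lieModType (loop k)) (u0 : M) (M0 : is_M0 u0) (n : nat).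
Local Notation L := (laurent k n).
Local Notation sym := (sym_avg (@perm_var k n)).

Definition word_map : {linear L -> M} := zext (fun x => fword u0 x).

Lemma word_mapE x : word_map (zmon k x) = fword u0 x.
Proof. exact: zextE. Qed.

Let word_map_perm s q : word_map (perm_var s q) = word_map q.
Proof. exact: (F_sg (@zmon_ind k n) (@perm_varE k n) word_mapE). Qed.

Lemma word_map_mull c (p q r : L) :
  word_map ((c *: p + q) * r) = c *: word_map (p * r) + word_map (q * r).
Proof. by rewrite mulrDl -scalerAl linearP. Qed.

Lemma word_map_mulr c (p q r : L) :
  word_map (r * (c *: p + q)) = c *: word_map (r * p) + word_map (r * q).
Proof. by rewrite mulrDr -scalerAr linearP. Qed.

Lemma sym_avg_perm s (q : L) : sym (perm_var s q) = sym q.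
Proof.
rewrite /sym_avg; congr (_ *: _); rewrite [RHS](reindex_inj (mulIg s)).
by apply: eq_bigr => t _; rewrite (sg_comp (@zmon_ind k n) (@perm_varE k n)).
Qed.

Let word_map_sym q : word_map (sym q) = word_map q.
Proof. exact: sym_avg_invariant. Qed.

(** Transported to the model, G sends a word of length n to the average of the corresponding
    monomial, which does not depend on the order of the letters. *)
Lemma layer_section : exists G : {linear M -> L},
  (forall q, G (word_map q) = sym q) /\ (forall v, layer n v -> word_map (G v) = v).
Proof.
pose X := multiset_module_exists k.
have [psi [psi_word psiK]] := to_fock_exists M0 X.
(* The value 0 at other lengths makes G vanish on the other layers. *)
pose g s : L := if size s == n then sym (zmon k [ffun i : 'I_n => nth 0 s i]) else 0.
have g_perm s t : perm_eq s t -> g s = g t.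
  move=> st; rewrite /g (perm_size st); case: eqP => [tn|_]; last by [].
  have /tuple_permP[p sE] : perm_eq s (tcast tn (in_tuple t)) by rewrite val_tcast.
  rewrite -(sym_avg_perm p (zmon k [ffun i : 'I_n => nth 0 t i])) perm_varE.
  congr (sym (zmon k _)); apply/ffunP => i; rewrite !ffunE sE.
  by rewrite -tnth_nth tnth_mktuple (tnth_nth 0) val_tcast.
(* In the model, F after G is the projection onto words of length n, which fixes the n-th layer. *)
have FG x : word_map (mm_ext X g x) = of_fock u0 X (fock_proj X n x).
  elim/mm_ind: x => [|c s x IHx]; first by rewrite !raddf0.
  rewrite !linearP /= IHx; congr (_ *: _ + _).
  rewrite mm_extE // fock_proj_word /g; case: eqP => [sn|_]; last by rewrite !raddf0.
  rewrite word_map_sym word_mapE of_fock_word fwordE; congr fseq.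
  apply: (@eq_from_nth _ 0); rewrite size_map size_enum_ord // => i i_n.
  by rewrite (nth_map (Ordinal i_n)) ?size_enum_ord // ffunE nth_enum_ord.
have psi_ofK x : psi (of_fock u0 X x) = x.
  elim/mm_ind: x => [|c s x IHx]; first by rewrite !raddf0.
  by rewrite !linearP /= IHx of_fock_word psi_word.
exists (mm_ext X g \o psi); split=> [q|v vn] /=.
  pose f : {linear L -> L} := mm_ext X g \o psi \o word_map.
  apply: (zmon_linear_eq (f := f) (g := sym)) => x.
  rewrite /f /= word_mapE fwordE psi_word mm_extE // /g size_map size_enum_ord eqxx.
  congr (sym (zmon k _)); apply/ffunP => i; rewrite ffunE.
  by rewrite (nth_map i) ?size_enum_ord // nth_ord_enum.
rewrite FG fock_proj_layer //.
rewrite -[LHS]psi_ofK (of_fockH M0) psiK vn linearZ //.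
Qed.

Lemma word_map_layer q : layer n (word_map q).
Proof. exact: (F_layer M0 (@zmon_ind k n) word_mapE). Qed.

Lemma msym_fun (gamma : 'I_n -> int) :
  msym k gamma = sym (zmon k [ffun i => gamma i]).
Proof.
rewrite -msymE /msym; congr (_ *: _); apply: eq_bigr => s _.
by apply: eq_bigr => i _; rewrite ffunE.
Qed.

Lemma word_map_msym (gamma chi : 'I_n -> int) :
  word_map (msym k gamma * zmon k [ffun i => chi i]) =
  (n`!%:R)^-1 *: \sum_(s : 'S_n) fword u0 (fun i => chi i + gamma (s i)).
Proof.
rewrite msym_fun /sym_avg -scalerAl linearZ /=; congr (_ *: _).
rewrite mulr_suml raddf_sum /=; apply: eq_bigr => s _.
rewrite perm_varE -zmonD word_mapE; apply: eq_fword => i.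
by rewrite !ffunE addrC.
Qed.

Let sym_sym q : symmetric_laurent (sym q).
Proof.
apply/symmetric_laurentP => s.
exact: (sg_sym_avg (@zmon_ind k n) (@perm_varE k n)).
Qed.

(** G v is a preimage of v under F, and p times it represents p . v. For symmetric p, averaging
    commutes with multiplication by p, whence compatibility with products. *)
Lemma layer_action_exists : exists act, is_layer_action u0 act (n := n).
Proof.
have [G [GF FG]] := layer_section.
have symM := sym_avg_mul (@perm_varM k n).
exists (fun p v => word_map (p * G v)); split.
- by move=> p v _ _; apply: word_map_layer.
- by move=> a p q v _ _ _; rewrite mulrDl -scalerAl linearP.
- by move=> a p v w _ _ _; rewrite linearP; apply: word_map_mulr.
- split=> [v vn|p q v /symmetric_laurentP p_sym /symmetric_laurentP q_sym vn].
    by rewrite mul1r FG.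
  by rewrite GF -symM // word_map_sym mulrA.
move=> gamma chi.
have -> : fword u0 chi = word_map (zmon k [ffun i => chi i]).
  by rewrite word_mapE; apply: eq_fword => i; rewrite ffunE.
rewrite GF -symM ?word_map_sym ?word_map_msym // msym_fun.
by apply/symmetric_laurentP/sym_sym.
Qed.

(** A symmetric p equals its own average and so is a combination of the m(gamma), on which the
    action is prescribed. *)
Lemma layer_actionE act p q : is_layer_action u0 act -> symmetric_laurent p ->
  act p (word_map q) = word_map (p * q).
Proof.
move=> [_ act_linl act_linr _ act_word] p_sym.
have layer0 : layer n (0 : M) by rewrite /layer !raddf0.
have act_p0 p' : symmetric_laurent p' -> act p' 0 = 0.
  move=> sp'; have /eqP := act_linr 1 p' 0 0 sp' layer0 layer0.
  by rewrite scaler0 addr0 scale1r eq_sym -subr_eq0 addrK => /eqP.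
have sym0 : symmetric_laurent (0 : L) by move=> s x; rewrite !mcoeff0.
have act_0v v : layer n v -> act 0 v = 0.
  move=> vn; have /eqP := act_linl 1 0 0 v sym0 sym0 vn.
  by rewrite scaler0 addr0 scale1r eq_sym -subr_eq0 addrK => /eqP.
elim/zmon_ind: q => [|c x q IHq]; first by rewrite mulr0 raddf0 act_p0.
rewrite (linearP word_map) /=.
rewrite (act_linr c p _ _ p_sym (word_map_layer _) (word_map_layer _)).
rewrite IHq word_map_mulr; congr (_ + _); congr (_ *: _).
(* With p replaced by [sym p], the induction can run over arbitrary p, whose monomials need not be
   symmetric. *)
rewrite -(sym_avg_id char0 (proj1 (symmetric_laurentP _) p_sym)).
have base y : act (sym (zmon k y)) (word_map (zmon k x)) =
    word_map (sym (zmon k y) * zmon k x).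
  rewrite -msymE word_mapE act_word -word_map_msym.
  by congr (word_map (_ * zmon k _)); apply/ffunP => i; rewrite ffunE.
elim/zmon_ind: {p_sym IHq} p => [|d y p IHp].
  by rewrite (raddf0 sym) mul0r raddf0 act_0v //; apply: word_map_layer.
rewrite (linearP sym) /=.
apply: etrans (act_linl d _ _ _ (sym_sym (zmon k y)) (sym_sym p)
  (word_map_layer (zmon k x))) _.
apply: etrans (congr2 (fun u v => d *: u + v) (base y) IHp) _.
exact/esym/word_map_mull.
Qed.

End Layer.

Arguments word_map {k M} u0 {n}.

Theorem theorem21 (k : fieldType) (char0 : [pchar k] =i pred0)
    (M : lieModType (loop k)) (u0 : M) (M0 : is_M0 u0)
    (n : nat) (n_gt0 : (0 < n)%N) :
  (exists act : laurent k n -> M -> M, is_layer_action u0 act) /\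
  forall act : laurent k n -> M -> M, is_layer_action u0 act ->
    [/\ forall v : M, OmegaM act v <->
          lin_span (fun w => exists chi : 'I_n -> int, w = wvec u0 chi) v,
        H_submodule_of_layer n (OmegaM act),
        exists2 v : M, OmegaM act v & v <> 0
      & forall v : M, OmegaM act v -> singular v].
Proof.
split=> [|act act_layer]; first exact: layer_action_exists.
have [G [GF FG]] := layer_section char0 M0 n.
have Om_sym : symmetric_laurent (Omega k n) by apply/symmetric_laurentP/Omega_sym.
(* Since F maps onto M_n, Omega . M_n is F (Omega L), and the action disappears from the
   argument. *)
have OmegaMP v : OmegaM act v <-> exists q, v = word_map u0 (Omega k n * q).
  split=> [[w wn ->]|[q ->]].
    by exists (G w); rewrite -(layer_actionE char0 M0 (G w) act_layer Om_sym) FG.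
  exists (word_map u0 q); first exact: word_map_layer.
  by rewrite (layer_actionE char0 M0).
have spanP := span_wvec (@zmonD k n) (@zmon_ind k n) (word_mapE u0 (n := n)).
have word_map_perm (s : 'S_n) (q : laurent k n) :
    word_map u0 (perm_var s q) = word_map u0 q.
  exact: (F_sg (@zmon_ind k n) (@perm_varE k n) (word_mapE u0 (n := n))).
have Om_span v : OmegaM act v <->
    lin_span (fun w => exists chi : 'I_n -> int, w = wvec u0 chi) v.
  rewrite OmegaMP spanP OmegaE; split=> [[q ->]|[q ->]].
    by exists (vdm (zmon k (n := n)) * q); rewrite mulrA.
  exact: (vdm_mul_invariant char0 (@zmonD k n) (@zmon0 k n) (@zmon_ind k n)
    (@perm_varM k n) (@perm_varE k n)).
split=> //.
- split.
  + by move=> v /OmegaMP[q ->]; apply: word_map_layer.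
  + by apply/OmegaMP; exists 0; rewrite mulr0 raddf0.
  + move=> a v w /OmegaMP[p ->] /OmegaMP[q ->]; apply/OmegaMP.
    by exists (a *: p + q); rewrite mulrDr -scalerAr linearP.
  move=> x v xH /OmegaMP[q ->]; apply/OmegaMP.
  have [m [c [s [sP ->]]]] := lact_loopH (word_map u0 (Omega k n * q)) xH.
  elim/big_rec: _ => [|i w _ [p ->]]; first by exists 0; rewrite mulr0 raddf0.
  have [j ->] := sP i.
  have hF := lact_hF M0 (@zmonD k n) (@zmon_ind k n) (word_mapE u0 (n := n)).
  exists (c i *: ((- 2 *: \sum_l var (zmon k (n := n)) l j) * q) + p).
  by rewrite word_map_mulr hF mulrCA.
(* The witness is Omega . f(0)^n u_0; G maps it back to Omega, which is its own average. *)
- exists (word_map u0 (Omega k n)); first by apply/OmegaMP; exists 1; rewrite mulr1.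
  move=> /(congr1 G); rewrite GF raddf0 (sym_avg_id char0 (@Omega_sym k n)) => Om0.
  by have := Omega_neq0 n char0; rewrite Om0 eqxx.
move=> v /Om_span[m [c [s [sP ->]]]] x xE.
rewrite raddf_sum /= big1 // => i _; rewrite linearZ /=.
by have [chi ->] := sP i; rewrite (wvec_singular char0 M0) ?scaler0.
Qed.
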